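(* Let $F,f:\mathbb R^n\times\mathbb R^m\to\mathbb R$, $G:\mathbb R^n\times\mathbb R^m\to\mathbb R^q$, $g:\mathbb R^n\times\mathbb R^m\to\mathbb R^p$ be continuously differentiable such that for each fixed $x$, $f(x,\cdot)$ is $\rho_f$-weakly convex and each component of $g(x,\cdot)$ is quasi-convex, and let $\gamma\in(0,\frac1{2\rho_f})$. Let $(\bar x,\bar y)$ be a local minimizer of $$(\mathrm{VP})_\gamma\qquad\min_{x,y}F(x,y)\quad\text{s.t. } f(x,y)-v_\gamma(x,y)\le0,\ g(x,y)\le0,\ G(x,y)\le0,$$ and let $(u,v)\in C(\bar x,\bar y)$, the critical cone of $(\mathrm{VP})_\gamma$. Suppose that either MFCQ for the system $g(\bar x,y)\le0$ holds at $y=\bar y$, or the following condition holds: $\nabla_xg(\bar x,\bar y)u\ne0$ and $\mathbb L(\bar x,\bar y;\alpha u)\ne\emptyset$ for any $\alpha\in\mathbb R$, the system $g(x,y)\le0$ satisfies MSCQ at $(\bar x,\bar y)$, and FOSCMS for the system $g(\bar x,y)\le0$ at $y=\bar y$ holds in direction $\nabla g(\bar x,\bar y)(\alpha u,v')$ for any $(\alpha,v')\ne0$ with $v'\in\mathbb L(\bar x,\bar y;\alpha u)$. Furthermore, suppose that $(\mathrm{VP})_\gamma$ is partially calm at $(\bar x,\bar y)$ in direction $(u,v)$. Then there exist $(\alpha,\lambda_g,\lambda_G)\in\mathbb R^{1+p+q}$ and $\bar\lambda\in\Lambda(\bar x,\bar y)$ satisfying $$0=\nabla F(\bar x,\bar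 y)+\nabla g(\bar x,\bar y)^T(\lambda_g-\alpha\bar\lambda)+\nabla G(\bar x,\bar y)^T\lambda_G,$$ $$\alpha\ge0,\ 0\le\lambda_g\perp g(\bar x,\bar y),\ \lambda_g\perp\nabla g(\bar x,\bar y)(u,v),\ 0\le\lambda_G\perp G(\bar x,\bar y),\ \lambda_G\perp\nabla G(\bar x,\bar y)(u,v).$$
   Context: Definitions. $\mathcal F(x):=\{y\in\mathbb R^m\mid g(x,y)\le0\}$; the Moreau envelope function is $v_\gamma(x,y):=\inf_w\{f(x,w)+\frac1{2\gamma}\|w-y\|^2\mid g(x,w)\le0\}$. A function $h$ is $\rho$-weakly convex ($\rho\ge0$) if $h+\frac\rho2\|\cdot\|^2$ is convex; if $\rho_f=0$, $1/(2\rho_f)$ is read as $+\infty$. Quasi-convex: all sublevel sets are convex. $I_g(x,y):=\{i\mid g_i(x,y)=0\}$, similarly $I_G$; $\nabla g(x,y)(u,v)=\nabla_xg(x,y)u+\nabla_yg(x,y)v$; $a\perp b$ means $\langle a,b\rangle=0$; $\mathbb B$ is the open unit ball; $a_+$ is the componentwise positive part. $\Lambda(x,y):=\{\lambda\in\mathbb R^p_+\mid\nabla_yf(x,y)+\nabla_yg(x,y)^T\lambda=0,\ g(x,y)^T\lambda=0\}$. $\mathbb L(\bar x,\bar y;\tilde u):=\{v'\in\mathbb R^m\mid\nabla g_i(\bar x,\bar y)(\tilde u,v')\le0,\ i\in I_g(\bar x,\bar y)\}$. Critical cone: $C(\bar x,\bar y):=\{(u,v)\mid\nabla f(\bar x,\bar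 y)(u,v)\le(v_\gamma)'_+(\bar x,\bar y;u,v),\ \nabla F(\bar x,\bar y)(u,v)\le0,\ \nabla g_i(\bar x,\bar y)(u,v)\le0\ \forall i\in I_g(\bar x,\bar y),\ \nabla G_i(\bar x,\bar y)(u,v)\le0\ \forall i\in I_G(\bar x,\bar y)\}$, where $\psi'_+(z;d):=\limsup_{t\downarrow0}\frac{\psi(z+td)-\psi(z)}t$. MFCQ for $g(\bar x,y)\le0$ at $\bar y$: $\nabla_yg(\bar x,\bar y)^T\lambda=0$, $0\le\lambda\perp g(\bar x,\bar y)$ imply $\lambda=0$. FOSCMS for this system at $\bar y$ in direction $\xi\in\mathbb R^p$: $\nabla_yg(\bar x,\bar y)^T\lambda=0$, $0\le\lambda\perp g(\bar x,\bar y)$, $\lambda\perp\xi$ imply $\lambda=0$. MSCQ for $g(x,y)\le0$ at $(\bar x,\bar y)$: there are $\epsilon,\kappa>0$ with $\operatorname{dist}((x,y),\{g\le0\})\le\kappa\|g_+(x,y)\|$ for all $(x,y)$ in the $\epsilon$-ball around $(\bar x,\bar y)$. Directional neighborhood: $\mathcal V_{\epsilon,\delta}(d):=\{z\in\epsilon\mathbb B\mid\big\|\|d\|z-\|z\|d\big\|\le\delta\|z\|\|d\|\}$. Partial calmness of $(\mathrm{VP})_\gamma$ at $(\bar x,\bar y)$ in direction $(u,v)$: there are $\epsilon,\delta,\rho>0$ such that for every $(\alpha,\beta)\in\epsilon\mathbb B\subset\mathbb R^{1+q}$ and every $(x,y)\in\operatorname{gph}\mathcal F\cap((\bar x,\bar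 y)+\mathcal V_{\epsilon,\delta}(u,v))$ with $f(x,y)-v_\gamma(x,y)+\alpha\le0$ and $G(x,y)+\beta\le0$ one has $F(x,y)-F(\bar x,\bar y)+\rho\|(\alpha,\beta)\|\ge0$. *)

(* Defs.v *)
(* R^k is 'rV[R]_k over R : realType, and R^n x R^m is the product type.
   The library norms are sup norms, used here only through their topology;
   metric notions use the Euclidean norms enorm and pnorm below. *)
From HB Require Import structures.
From mathcomp Require Import all_boot all_order all_algebra.
From mathcomp Require Import all_classical all_reals all_analysis.

Set Implicit Arguments.
Unset Strict Implicit.
Unset Printing Implicit Defensive.

Import Order.TTheory GRing.Theory Num.Theory.
Import numFieldNormedType.Exports.

Local Open Scope classical_set_scope.
Local Open Scope ring_scope.

Notation prodRV R n m := ('rV[R]_n * 'rV[R]_m)%type.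

Definition dotv (R : realType) k (a b : 'rV[R]_k) : R :=
  \sum_(i < k) a 0 i * b 0 i.

Definition enorm (R : realType) k (a : 'rV[R]_k) : R := Num.sqrt (dotv a a).

Definition pnorm (R : realType) n m (z : prodRV R n m) : R :=
  enorm (row_mx z.1 z.2).

Definition nonnegv (R : realType) k (a : 'rV[R]_k) : Prop :=
  forall i, 0 <= a 0 i.

Definition nonposv (R : realType) k (a : 'rV[R]_k) : Prop :=
  forall i, a 0 i <= 0.

Definition posv (R : realType) k (a : 'rV[R]_k) : 'rV[R]_k :=
  \row_i Num.max (a 0 i) 0.

Definition gradx (R : realType) n m (h : prodRV R n m -> R) (z : prodRV R n m) :
    'rV[R]_n :=
  \row_j 'd (fun x : 'rV[R]_n => h (x, z.2)) (z.1 : 'rV[R]_n) (delta_mx 0 j).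

Definition grady (R : realType) n m (h : prodRV R n m -> R) (z : prodRV R n m) :
    'rV[R]_m :=
  \row_j 'd (fun y : 'rV[R]_m => h (z.1, y)) (z.2 : 'rV[R]_m) (delta_mx 0 j).

(* nabla h (z) d *)
Definition gradv (R : realType) n m (h : prodRV R n m -> R)
    (z d : prodRV R n m) : R :=
  dotv (gradx h z) d.1 + dotv (grady h z) d.2.

(* Vectors being rows, the library's jacobian is the transpose of the usual
   Jacobian matrix: (nabla_x h) u is u *m jacx h z, and (nabla_x h)^T lambda is
   lambda *m (jacx h z)^T. *)
Definition jacx (R : realType) n m k (h : prodRV R n m -> 'rV[R]_k)
    (z : prodRV R n m) : 'M[R]_(n, k) :=
  jacobian (fun x : 'rV[R]_n => h (x, z.2)) z.1.

Definition jacy (R : realType) n m k (h : prodRV R n m -> 'rV[R]_k)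
    (z : prodRV R n m) : 'M[R]_(m, k) :=
  jacobian (fun y : 'rV[R]_m => h (z.1, y)) z.2.

Definition jacv (R : realType) n m k (h : prodRV R n m -> 'rV[R]_k)
    (z d : prodRV R n m) : 'rV[R]_k :=
  d.1 *m jacx h z + d.2 *m jacy h z.

Definition C1_scalar (R : realType) n m (h : prodRV R n m -> R) : Prop :=
  (forall z, differentiable h z) /\
  continuous (gradx h) /\ continuous (grady h).

Definition C1_vector (R : realType) n m k (h : prodRV R n m -> 'rV[R]_k) : Prop :=
  (forall z, differentiable h z) /\
  continuous (jacx h) /\ continuous (jacy h).

Definition weakly_convex (R : realType) m (rho : R) (h : 'rV[R]_m -> R) : Prop :=
  0 <= rho /\
  convex_function setT (fun y : 'rV[R]_m => h y + rho / 2 * enorm y ^+ 2).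

Definition quasi_convex (R : realType) m (h : 'rV[R]_m -> R) : Prop :=
  forall c : R, convex_set [set y : 'rV[R]_m | h y <= c].

Definition lower_feasible (R : realType) n m p (g : prodRV R n m -> 'rV[R]_p)
    (x : 'rV[R]_n) : set 'rV[R]_m :=
  [set y | nonposv (g (x, y))].

(* Extended-real valued: +oo when the lower-level feasible set is empty. *)
Definition moreau_env (R : realType) n m p (f : prodRV R n m -> R)
    (g : prodRV R n m -> 'rV[R]_p) (gamma : R) (z : prodRV R n m) : \bar R :=
  ereal_inf [set (f (z.1, w) + (2 * gamma)^-1 * enorm (w - z.2) ^+ 2)%:E
            | w in lower_feasible g z.1].

Definition upper_dini (R : realType) n m (psi : prodRV R n m -> \bar R)
    (z d : prodRV R n m) : \bar R :=
  limf_esup (fun t : R => ((psi (z + t *: d)%R - psi z) * (t^-1)%:E)%E) 0^'+.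

Definition VP_feasible (R : realType) n m p q (f : prodRV R n m -> R)
    (g : prodRV R n m -> 'rV[R]_p) (G : prodRV R n m -> 'rV[R]_q) (gamma : R)
    (z : prodRV R n m) : Prop :=
  [/\ ((f z)%:E - moreau_env f g gamma z <= 0)%E, nonposv (g z) & nonposv (G z)].

Definition VP_local_minimizer (R : realType) n m p q (F f : prodRV R n m -> R)
    (g : prodRV R n m -> 'rV[R]_p) (G : prodRV R n m -> 'rV[R]_q) (gamma : R)
    (zbar : prodRV R n m) : Prop :=
  VP_feasible f g G gamma zbar /\
  exists2 e : R, 0 < e &
    forall z, pnorm (z - zbar) < e -> VP_feasible f g G gamma z -> F zbar <= F z.

Definition critical_cone (R : realType) n m p q (F f : prodRV R n m -> R)
    (g : prodRV R n m -> 'rV[R]_p) (G : prodRV R n m -> 'rV[R]_q) (gamma : R)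
    (z : prodRV R n m) : set (prodRV R n m) :=
  [set d | [/\ ((gradv f z d)%:E <= upper_dini (moreau_env f g gamma) z d)%E,
               gradv F z d <= 0,
               forall i, g z 0 i = 0 -> jacv g z d 0 i <= 0 &
               forall i, G z 0 i = 0 -> jacv G z d 0 i <= 0]].

Definition multipliers (R : realType) n m p (f : prodRV R n m -> R)
    (g : prodRV R n m -> 'rV[R]_p) (z : prodRV R n m) : set 'rV[R]_p :=
  [set l | [/\ nonnegv l, grady f z + l *m (jacy g z)^T = 0 & dotv (g z) l = 0]].

Definition linearized_dirs (R : realType) n m p (g : prodRV R n m -> 'rV[R]_p)
    (z : prodRV R n m) (u : 'rV[R]_n) : set 'rV[R]_m :=
  [set v | forall i, g z 0 i = 0 -> jacv g z (u, v) 0 i <= 0].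

(* MFCQ and FOSCMS are for the system g(z.1, y) <= 0 in y, at y = z.2. *)
Definition MFCQ (R : realType) n m p (g : prodRV R n m -> 'rV[R]_p)
    (z : prodRV R n m) : Prop :=
  forall l : 'rV[R]_p,
    l *m (jacy g z)^T = 0 -> nonnegv l -> dotv l (g z) = 0 -> l = 0.

Definition FOSCMS (R : realType) n m p (g : prodRV R n m -> 'rV[R]_p)
    (z : prodRV R n m) (xi : 'rV[R]_p) : Prop :=
  forall l : 'rV[R]_p,
    l *m (jacy g z)^T = 0 -> nonnegv l -> dotv l (g z) = 0 -> dotv l xi = 0 ->
    l = 0.

Definition edist_to (R : realType) n m (z : prodRV R n m)
    (A : set (prodRV R n m)) : \bar R :=
  ereal_inf [set (pnorm (z - w))%:E | w in A].

Definition MSCQ (R : realType) n m p (g : prodRV R n m -> 'rV[R]_p)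
    (zbar : prodRV R n m) : Prop :=
  exists e kappa : R, [/\ 0 < e, 0 < kappa &
    forall z, pnorm (z - zbar) < e ->
      (edist_to z [set w | nonposv (g w)] <= (kappa * enorm (posv (g z)))%:E)%E].

Definition dir_nbhd (R : realType) n m (e delta : R) (d : prodRV R n m) :
    set (prodRV R n m) :=
  [set z | pnorm z < e /\
    pnorm (pnorm d *: z - pnorm z *: d) <= delta * pnorm z * pnorm d].

Definition partially_calm (R : realType) n m p q (F f : prodRV R n m -> R)
    (g : prodRV R n m -> 'rV[R]_p) (G : prodRV R n m -> 'rV[R]_q) (gamma : R)
    (zbar d : prodRV R n m) : Prop :=
  exists e delta rho : R, [/\ 0 < e, 0 < delta, 0 < rho &
    forall (a : R) (b : 'rV[R]_q) (z : prodRV R n m),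
      pnorm (a%:M : 'rV[R]_1, b) < e ->
      lower_feasible g z.1 z.2 ->
      dir_nbhd e delta d (z - zbar) ->
      ((f z)%:E - moreau_env f g gamma z + a%:E <= 0)%E ->
      nonposv (G z + b) ->
      0 <= F z - F zbar + rho * pnorm (a%:M : 'rV[R]_1, b)].

(* Main.v *)
Require Import Defs.
From mathcomp Require Import all_boot all_order all_algebra.
From mathcomp Require Import all_classical all_reals all_analysis.
From mathcomp Require Import ring lra.

(** Write [phi_z w = f (x, w) + |w - y|^2 / (2 gamma)] for [z = (x, y)], so that
    the envelope [v_gamma z] is the infimum of [phi_z] over the points [w] with
    [g (x, w) <= 0], and let [d = (u, v)].

    Feasibility of [zbar] means that [zbar.2] minimises [phi_zbar]. Weak
    convexity of [f] and quasi-convexity of [g] make this minimiser unique and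
    stable: near-minimisers of [phi_z] tend to [zbar.2] as [z] tends to [zbar]
    ([prox_stable]).

    Either constraint qualification yields MFCQ ([FOSCMS_MFCQ]), hence a
    direction that points strictly into the active lower-level constraints
    ([MFCQ_inward]). This is used to shift a near-minimiser for a moved
    parameter back to a feasible point of the original one, at a cost that is
    known to first order ([prox_obj_shift]): the envelope satisfies
    [v_gamma (z + t e) >= v_gamma z - t (nabla f zbar (- e.1, xi)) - o(t)],
    uniformly for [z] near [zbar], whenever [(- e.1, xi)] points strictly into
    the active constraints.

    As [d] is critical, [v_gamma (zbar + t d)] is at least
    [f zbar + t (nabla f zbar d) - o(t)] along some sequence of [t]. Going on
    from [zbar + t d] to [zbar + t (d + s e)] with a small fixed [s] stays
    inside the directional neighbourhood, keeps [g <= 0], and violates the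
    remaining constraints by quantities that are controlled to first order.
    Partial calmness with modulus [rho] charges this violation, and the
    outcome ([calm_first_order]) is that
    [0 <= nabla F zbar e + rho (nabla_y f zbar (e.2 + xi))]
    for all [(e, xi)] in a polyhedral cone: [(- e.1, xi)] does not increase the
    active [g_i], and [e] does not increase those active [g_i] and [G_i] that
    have zero slope along [d]. The strict inequalities that the estimates
    require are removed by a perturbation along the inward direction.

    Farkas' lemma turns this into multipliers ([multipliers_of_first_order]).
    The coefficient of the free variable [xi] is exactly the stationarity
    condition that defines [Lambda], scaled by [rho]; so [alpha = rho], and the
    multiplier [lambdabar] is produced by the same application. *)

Set Implicit Arguments.
Unset Strict Implicit.
Unset Printing Implicit Defensive.

Import Order.TTheory GRing.Theory Num.Theory.
Import numFieldNormedType.Exports.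
Local Open Scope classical_set_scope.
Local Open Scope ring_scope.

(** * Inner products and Euclidean norms *)

Section Dot.
Context {R : realType} {k : nat}.
Implicit Types a b c : 'rV[R]_k.

Lemma dotvC a b : dotv a b = dotv b a.
Proof. by apply: eq_bigr => i _; rewrite mulrC. Qed.

Lemma dotvDr a b c : dotv a (b + c) = dotv a b + dotv a c.
Proof. by rewrite -big_split; apply: eq_bigr => i _; rewrite mxE mulrDr. Qed.

Lemma dotvZr t a b : dotv a (t *: b) = t * dotv a b.
Proof. by rewrite mulr_sumr; apply: eq_bigr => i _; rewrite mxE mulrCA. Qed.

Lemma dotvDl a b c : dotv (a + b) c = dotv a c + dotv b c.
Proof. by rewrite !(dotvC _ c) dotvDr. Qed.

Lemma dotvZl t a b : dotv (t *: a) b = t * dotv a b.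
Proof. by rewrite !(dotvC _ b) dotvZr. Qed.

Lemma dotvNr a b : dotv a (- b) = - dotv a b.
Proof. by rewrite -scaleN1r dotvZr mulN1r. Qed.

Lemma dotvNl a b : dotv (- a) b = - dotv a b.
Proof. by rewrite dotvC dotvNr dotvC. Qed.

Lemma dotv0r a : dotv a 0 = 0.
Proof. by rewrite -(scale0r 0) dotvZr mul0r. Qed.

Lemma dotv0l a : dotv 0 a = 0.
Proof. by rewrite dotvC dotv0r. Qed.

Lemma dotvv_ge0 a : 0 <= dotv a a.
Proof. by apply: sumr_ge0 => i _; rewrite -expr2 sqr_ge0. Qed.

Lemma dotvv_eq0 a : dotv a a = 0 -> a = 0.
Proof.
move=> /eqP; rewrite psumr_eq0 => [/allP a0|i _]; last by rewrite -expr2 sqr_ge0.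
apply/rowP => i; rewrite mxE; apply/eqP.
by have := a0 i (mem_index_enum _); rewrite mulf_eq0 orbb.
Qed.

Lemma enorm_sqr a : enorm a ^+ 2 = dotv a a.
Proof. by rewrite sqr_sqrtr // dotvv_ge0. Qed.

Lemma normr_coord_le a i : `|a 0 i| <= `|a|.
Proof.
rewrite [leRHS]/Num.Def.normr/= mx_normrE.
exact: (le_bigmax _ (fun ij => `|a ij.1 ij.2|) (0, i)).
Qed.

Lemma dotv_norm_le a b : `|dotv a b| <= k%:R * (`|a| * `|b|).
Proof.
apply: le_trans (ler_norm_sum _ _ _) _.
have -> : k%:R * (`|a| * `|b|) = \sum_(i < k) `|a| * `|b|.
  by rewrite sumr_const card_ord mulr_natl.
apply: ler_sum => i _.
by rewrite normrM ler_pM// normr_coord_le.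
Qed.

Lemma enorm_le_norm a : enorm a <= k%:R * `|a|.
Proof.
rewrite -(ler_pXn2r (n := 2)) ?nnegrE ?sqrtr_ge0 ?mulr_ge0//.
rewrite enorm_sqr (le_trans (ler_norm _))// (le_trans (dotv_norm_le _ _))//.
rewrite exprMn -expr2 ler_wpM2r ?sqr_ge0// -natrX ler_nat.
by case: k => // k'; rewrite leq_pmulr.
Qed.

Lemma enormZ t a : enorm (t *: a) = `|t| * enorm a.
Proof. by rewrite /enorm dotvZl dotvZr mulrA -expr2 sqrtrM ?sqr_ge0// sqrtr_sqr. Qed.

End Dot.

Lemma enorm_le_coord (R : realType) k (a : 'rV[R]_k) b : 0 <= b ->
  (forall i, `|a 0 i| <= b) -> enorm a <= k%:R * b.
Proof.
move=> b0 ab; rewrite (le_trans (enorm_le_norm _))// ler_wpM2l//.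
rewrite [leLHS]/Num.Def.normr/= mx_normrE.
by apply: bigmax_le => // -[i j] _; rewrite ord1.
Qed.

Lemma enorm_sqr_diff_le (R : realType) k (a b c : 'rV[R]_k) :
  enorm (a + b) ^+ 2 - enorm (a - c) ^+ 2 <=
  k%:R * (`|b + c| * (2 * `|a| + `|b| + `|c|)).
Proof.
have -> : enorm (a + b) ^+ 2 - enorm (a - c) ^+ 2 =
    dotv (b + c) (2 *: a + b - c).
  rewrite !enorm_sqr !(dotvDl, dotvDr, dotvNl, dotvNr, dotvZr).
  rewrite (dotvC b a) (dotvC c a) (dotvC c b); ring.
rewrite (le_trans (ler_norm _))// (le_trans (dotv_norm_le _ _))//.
rewrite ler_wpM2l// ler_wpM2l// (le_trans (ler_normD _ _))// normrN lerD2r.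
by rewrite (le_trans (ler_normD _ _))// normrZ ger0_norm.
Qed.

Lemma dotv_row_mx (R : realType) k l (a : 'rV[R]_k) (b : 'rV[R]_l) c d :
  dotv (row_mx a b) (row_mx c d) = dotv a c + dotv b d.
Proof.
rewrite /dotv big_split_ord/=; congr (_ + _); apply: eq_bigr => i _.
  by rewrite !row_mxEl.
by rewrite !row_mxEr.
Qed.

Lemma mulmx_tr_dotv (R : realType) k l (A : 'M[R]_(l, k)) (b : 'rV[R]_k) c :
  dotv (b *m A^T) c = dotv b (c *m A).
Proof.
have dE i (x y : 'rV[R]_i) : dotv x y = (x *m y^T) 0 0.
  by rewrite mxE; apply: eq_bigr => j _; rewrite !mxE.
by rewrite !dE trmx_mul mulmxA.
Qed.

Section EuclideanContinuity.
Context {R : realType}.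

Lemma continuous_dotvv k : continuous (fun a : 'rV[R]_k => dotv a a).
Proof.
apply: continuous_big => [|i _ a]; first exact: add_continuous.
have ci : continuous (fun a : 'rV[R]_k => a 0 i) by exact: coord_continuous.
exact: continuousM (ci a) (ci a).
Qed.

Lemma pnormE n m (z : prodRV R n m) :
  pnorm z = Num.sqrt (dotv z.1 z.1 + dotv z.2 z.2).
Proof. by rewrite /pnorm /enorm dotv_row_mx. Qed.

Lemma pnorm_ge0 n m (z : prodRV R n m) : 0 <= pnorm z.
Proof. exact: sqrtr_ge0. Qed.

Lemma continuous_pnorm n m : continuous (@pnorm R n m).
Proof.
rewrite (_ : @pnorm R n m =
    Num.sqrt \o (fun z => dotv z.1 z.1 + dotv z.2 z.2)); last first.
  by apply/funext => z; exact: pnormE.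
move=> z; apply: continuous_comp; last exact: sqrt_continuous.
apply: cvgD.
  apply: (@continuous_comp _ _ _ fst (fun a => dotv a a)); first exact: cvg_fst.
  exact: continuous_dotvv.
apply: (@continuous_comp _ _ _ snd (fun a => dotv a a)); first exact: cvg_snd.
exact: continuous_dotvv.
Qed.

Lemma pnormZ n m t (z : prodRV R n m) : pnorm (t *: z) = `|t| * pnorm z.
Proof. by rewrite /pnorm -enormZ scale_row_mx. Qed.

Lemma pnorm0 n m : pnorm (0 : prodRV R n m) = 0.
Proof. by rewrite pnormE !dotv0l addr0 sqrtr0. Qed.

Lemma pnorm_le_add n m (z : prodRV R n m) : pnorm z <= enorm z.1 + enorm z.2.
Proof.
have z0 : 0 <= enorm z.1 + enorm z.2 by rewrite addr_ge0// sqrtr_ge0.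
rewrite pnormE -[leRHS]ger0_norm// -sqrtr_sqr ler_wsqrtr//.
rewrite sqrrD !enorm_sqr addrAC lerDl.
by rewrite mulrn_wge0// mulr_ge0 ?sqrtr_ge0.
Qed.

End EuclideanContinuity.

(** * Farkas' lemma *)

Section Farkas.
Context {R : realType} {k : nat}.

(** Bartl's induction on the number of forms. If a form [b] cannot be dropped,
    some [x0] violates the conclusion while satisfying the other constraints,
    so that [b x0 > 0]; normalise it to [1]. Projecting every form along [x0] onto
    the kernel of [b] leaves a system with one form less, and the coefficient
    of [b] is read off at [x0]. *)
Lemma farkas_seq (I : eqType) (s : seq I) (a : I -> 'rV[R]_k) (c : 'rV[R]_k) :
  uniq s ->
  (forall x, {in s, forall i, dotv (a i) x <= 0} -> dotv c x <= 0) ->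
  exists2 mu : I -> R, (forall i, 0 <= mu i) & c = \sum_(i <- s) mu i *: a i.
Proof.
elim: s a c => [a c _ c_le0|j s IHs a c /= /andP[js us] c_le0].
  exists (fun=> 0) => //; rewrite big_nil; apply: dotvv_eq0; apply/le_anti.
  by rewrite dotvv_ge0 andbT; apply: c_le0.
have [s_le0|] := pselect
    (forall x, {in s, forall i, dotv (a i) x <= 0} -> dotv c x <= 0).
  have [mu mu0 ->] := IHs a c us s_le0.
  exists (fun i => if i == j then 0 else mu i) => [i|]; first by case: ifP.
  rewrite big_cons eqxx scale0r add0r; apply: eq_big_seq => i si.
  by rewrite (_ : i == j = false)//; apply/negbTE; apply: contraNneq js => <-.
move=> /existsNP[x0 /not_implyP[sx0 /negP]]; rewrite -ltNge => cx0.
have jx0 : 0 < dotv (a j) x0.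
  rewrite ltNge; apply/negP => jx0; have := c_le0 x0.
  rewrite leNgt cx0 => /(_ _)/wrap[]// i; rewrite inE => /predU1P[->//|].
  exact: sx0.
pose b := (dotv (a j) x0)^-1 *: a j.
have bx0 : dotv b x0 = 1 by rewrite dotvZl mulVf ?gt_eqF.
have projE e x : dotv (e - dotv e x0 *: b) x = dotv e (x - dotv b x *: x0).
  by rewrite dotvDl dotvNl dotvZl dotvDr dotvNr dotvZr mulrC.
have [x x_le0|mu mu0 Ec] :=
    IHs (fun i => a i - dotv (a i) x0 *: b) (c - dotv c x0 *: b) us.
  rewrite projE; apply: c_le0 => i; rewrite inE => /predU1P[->|si].
    have -> : dotv (a j) = fun y => dotv (a j) x0 * dotv b y.
      by apply/funext => y; rewrite dotvZl mulrA divff ?mul1r ?gt_eqF.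
    by rewrite dotvDr dotvNr dotvZr bx0 mulr1 subrr mulr0.
  by rewrite -projE; exact: x_le0.
pose nu := (dotv c x0 - \sum_(i <- s) mu i * dotv (a i) x0) / dotv (a j) x0.
exists (fun i => if i == j then nu else mu i) => [i|].
  case: ifP => // _; rewrite divr_ge0 ?(ltW jx0)// subr_ge0.
  rewrite (le_trans _ (ltW cx0))// big_seq sumr_le0// => l sl.
  by rewrite mulr_ge0_le0// sx0.
rewrite big_cons eqxx.
rewrite (eq_big_seq (fun i => mu i *: a i)) => [|i si]; last first.
  by rewrite (_ : i == j = false)//; apply/negbTE; apply: contraNneq js => <-.
have -> : nu *: a j = (dotv c x0 - \sum_(i <- s) mu i * dotv (a i) x0) *: b.
  by rewrite /b scalerA.
rewrite -[LHS](subrK (dotv c x0 *: b)) Ec.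
rewrite (eq_bigr _ (fun i _ => scalerBr (mu i) (a i) _)) sumrB.
rewrite (eq_bigr _ (fun i _ => scalerA (mu i) (dotv (a i) x0) b)).
by rewrite -scaler_suml scalerBl addrAC -addrA addrC.
Qed.

Lemma farkas (I : finType) (a : I -> 'rV[R]_k) (c : 'rV[R]_k) :
  (forall x, (forall i, dotv (a i) x <= 0) -> dotv c x <= 0) ->
  exists2 mu : I -> R, (forall i, 0 <= mu i) & c = \sum_i mu i *: a i.
Proof.
move=> c_le0; apply: farkas_seq (index_enum_uniq I) _ => x x_le0.
by apply: c_le0 => i; apply: x_le0; exact: mem_index_enum.
Qed.

End Farkas.

(** * Strict differentiability of C^1 functions *)

Lemma prod_norm_fst (R : realType) n m (z : prodRV R n m) : `|z.1| <= `|z|.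
Proof. by rewrite prod_normE le_max lexx. Qed.

Lemma prod_norm_snd (R : realType) n m (z : prodRV R n m) : `|z.2| <= `|z|.
Proof. by rewrite prod_normE le_max lexx orbT. Qed.

Section Gradient.
Context {R : realType} {n m : nat}.
Implicit Types (h : prodRV R n m -> R) (z d : prodRV R n m).

Lemma gradvD h z d e : gradv h z (d + e) = gradv h z d + gradv h z e.
Proof. by rewrite /gradv !dotvDr addrACA. Qed.

Lemma gradvZ h z t d : gradv h z (t *: d) = t * gradv h z d.
Proof. by rewrite /gradv !dotvZr mulrDr. Qed.

Lemma linear_dotE k (L : {linear 'rV[R]_k -> R}) (d : 'rV[R]_k) :
  dotv (\row_j L (delta_mx 0 j)) d = L d.
Proof.
rewrite {2}(row_sum_delta d) linear_sum; apply: eq_bigr => j _.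
by rewrite linearZ mxE mulrC.
Qed.

(** The partial derivatives of the definitions are restrictions of the full
    differential, since freezing one variable is an affine map. *)
Lemma diff_partial1 (W : normedModType R) (h : prodRV R n m -> W) z (d : 'rV[R]_n) :
  differentiable h z ->
  differentiable (fun x : 'rV[R]_n => h (x, z.2)) (z.1 : 'rV[R]_n) /\
  'd (fun x : 'rV[R]_n => h (x, z.2)) (z.1 : 'rV[R]_n) d = 'd h z (d, 0).
Proof.
case: z => x y /= dh.
have di : is_diff x (fun x' : 'rV[R]_n => (x', y)) (fun e => (e, 0)).
  have i1 : is_diff x (@id 'rV[R]_n) id by exact: is_diff_id.
  have i2 : is_diff x (fun=> y) (0 : 'rV[R]_n -> 'rV[R]_m) by exact: is_diff_cst.
  exact: is_diff_pair i1 i2.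
have := @is_diff_comp _ _ _ _ _ _ h ('d h (x, y)) x di (differentiableP dh).
by move=> [? E]; split => //; rewrite [in LHS]E.
Qed.

Lemma diff_partial2 (W : normedModType R) (h : prodRV R n m -> W) z (d : 'rV[R]_m) :
  differentiable h z ->
  differentiable (fun y : 'rV[R]_m => h (z.1, y)) (z.2 : 'rV[R]_m) /\
  'd (fun y : 'rV[R]_m => h (z.1, y)) (z.2 : 'rV[R]_m) d = 'd h z (0, d).
Proof.
case: z => x y /= dh.
have di : is_diff y (fun y' : 'rV[R]_m => (x, y')) (fun e => (0, e)).
  have i1 : is_diff y (@id 'rV[R]_m) id by exact: is_diff_id.
  have i2 : is_diff y (fun=> x) (0 : 'rV[R]_m -> 'rV[R]_n) by exact: is_diff_cst.
  exact: is_diff_pair i2 i1.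
have := @is_diff_comp _ _ _ _ _ _ h ('d h (x, y)) y di (differentiableP dh).
by move=> [? E]; split => //; rewrite [in LHS]E.
Qed.

Lemma diff_gradv h z d : differentiable h z -> 'd h z d = gradv h z d.
Proof.
move=> dh; rewrite /gradv /gradx /grady !linear_dotE.
rewrite (diff_partial1 d.1 dh).2 (diff_partial2 d.2 dh).2 -linearD.
by congr ('d h z _); case: d => d1 d2; rewrite -[RHS]/(d1 + 0, 0 + d2) addr0 add0r.
Qed.

Lemma is_derive_segment h z d (t : R) : (forall z', differentiable h z') ->
  is_derive t 1 (fun s : R => h (z + s *: d)) (gradv h (z + t *: d) d).
Proof.
move=> dh.
have di : is_diff t (fun s : R => z + s *: d) (fun e => e *: d).
  have i1 : is_diff t (fun=> z) (0 : R -> prodRV R n m) by exact: is_diff_cst.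
  have i2 : is_diff t (fun s : R => s *: d) (fun e => e *: d).
    exact: is_diff_scalel.
  rewrite (_ : (fun e => e *: d) = 0 + (fun e : R => e *: d)); last first.
    by rewrite add0r.
  exact: is_diffD i1 i2.
have [df E] := @is_diff_comp _ _ _ _ _ _ h _ t di (differentiableP (dh _)).
split; first exact: diff_derivable.
by rewrite deriveE // E /= scale1r diff_gradv.
Qed.

(** A C^1 function is strictly differentiable: both end points of the segment
    may vary near [z0], which makes the error uniform. This is needed because
    the envelope is compared between two moving points, none of them [z0]. *)
Lemma C1_strict_diff h z0 eps : C1_scalar h -> 0 < eps ->
  exists2 r, 0 < r & forall z d, `|z - z0| < r -> `|z + d - z0| < r ->
    `|h (z + d) - h z - gradv h z0 d| <= eps * `|d|.
Proof.
move=> [dh [cx cy]] e0.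
pose K : R := (n + m).+1%:R.
have K0 : 0 < K by rewrite ltr0n.
have eK0 : 0 < eps / K by rewrite divr_gt0.
have : \forall z \near z0, `|gradx h z0 - gradx h z| < eps / K /\
                           `|grady h z0 - grady h z| < eps / K.
  near=> z; split; near: z.
    by move/cvgrPdist_lt : (cx z0); apply.
  by move/cvgrPdist_lt : (cy z0); apply.
move=> /nbhs_ballP[r /= r0 rP]; exists r => // z d zr zdr.
have hcont : continuous (fun s : R => h (z + s *: d)).
  move=> s; apply: differentiable_continuous; apply/derivable1_diffP.
  by have [] := is_derive_segment z d s dh.
have [c] := @MVT_segment R (fun s => h (z + s *: d))
  (fun s => gradv h (z + s *: d) d) 0 1 ler01
  (fun x _ => is_derive_segment z d x dh) (continuous_subspaceT hcont).
rewrite in_itv/= => /andP[c0 c1]; rewrite scale1r scale0r addr0 subr0 mulr1 => ->.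
have [] : `|gradx h z0 - gradx h (z + c *: d)| < eps / K /\
          `|grady h z0 - grady h (z + c *: d)| < eps / K.
  apply: rP; rewrite -ball_normE /ball_/= distrC.
  have -> : z + c *: d - z0 = (1 - c) *: (z - z0) + c *: (z + d - z0).
    rewrite [z + d - z0]addrAC scalerBl scale1r [c *: (_ + d)]scalerDr.
    by rewrite addrA subrK addrAC.
  rewrite (le_lt_trans (ler_normD _ _))// !normrZ !ger0_norm ?subr_ge0//.
  have [->|cn0] := eqVneq c 0; first by rewrite mul0r addr0 subr0 mul1r.
  have : c * `|z + d - z0| < c * r by rewrite ltr_pM2l// lt_neqAle eq_sym cn0.
  have : (1 - c) * `|z - z0| <= (1 - c) * r by rewrite ler_wpM2l ?subr_ge0// ltW.
  lra.
rewrite /gradv; move: (gradx h z0) (grady h z0).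
move: (gradx h (z + c *: d)) (grady h (z + c *: d)) => a b a0 b0 gx gy.
rewrite (_ : _ - _ = - (dotv (a0 - a) d.1 + dotv (b0 - b) d.2)); last first.
  by rewrite !dotvDl !dotvNl; ring.
rewrite normrN (le_trans (ler_normD _ _))//.
have H1 : `|dotv (a0 - a) d.1| <= n%:R * (eps / K * `|d|).
  rewrite (le_trans (dotv_norm_le _ _))// ler_wpM2l// ler_pM// ?prod_norm_fst//.
  exact: ltW.
have H2 : `|dotv (b0 - b) d.2| <= m%:R * (eps / K * `|d|).
  rewrite (le_trans (dotv_norm_le _ _))// ler_wpM2l// ler_pM// ?prod_norm_snd//.
  exact: ltW.
rewrite (le_trans (lerD H1 H2))// -mulrDl mulrA ler_wpM2r//.
rewrite mulrCA ger_pMr// ler_pdivrMr// mul1r -natrD ler_nat.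
exact: leqnSn.
Unshelve. all: by end_near. Qed.

End Gradient.

Section Coordinate.
Context {R : realType} {n m k : nat}.
Implicit Types (h : prodRV R n m -> 'rV[R]_k) (z d : prodRV R n m).

Lemma diff_coord (V : normedModType R) (h : V -> 'rV[R]_k) x i :
  differentiable h x ->
  differentiable (fun y => h y 0 i) x /\
  forall e, 'd (fun y => h y 0 i) x e = ('d h x e) 0 i.
Proof.
move=> dh.
have di : is_diff (h x) (fun v : 'rV[R]_k => v 0 i) (fun v : 'rV[R]_k => v 0 i).
  apply: DiffDef; first exact: differentiable_coord.
  have @L : {linear 'rV[R]_k -> R}.
    by exists (fun N : 'rV[R]_k => N 0 i); do 2![eexists]; do ?[constructor];
       rewrite ?mxE// => ? *; rewrite ?mxE//; move=> ?; rewrite !mxE.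
  by rewrite (_ : (fun v : 'rV[R]_k => v 0 i) = L)// diff_lin//; exact: coord_continuous.
have [? E] := @is_diff_comp _ _ _ _ h _ _ _ x (differentiableP dh) di.
by split => // d; rewrite [in LHS]E.
Qed.

Lemma gradx_coord h z i : differentiable h z ->
  gradx (fun z => h z 0 i) z = (col i (jacx h z))^T.
Proof.
move=> dh; apply/rowP => j; rewrite !mxE/=.
have [dhx _] := diff_partial1 0 dh.
by rewrite (diff_coord i dhx).2.
Qed.

Lemma grady_coord h z i : differentiable h z ->
  grady (fun z => h z 0 i) z = (col i (jacy h z))^T.
Proof.
move=> dh; apply/rowP => j; rewrite !mxE/=.
have [dhy _] := diff_partial2 0 dh.
by rewrite (diff_coord i dhy).2.
Qed.

Lemma dotv_col l (A : 'M[R]_(l, k)) (d : 'rV[R]_l) i : dotv (col i A)^T d = (d *m A) 0 i.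
Proof. by rewrite mxE; apply: eq_bigr => j _; rewrite !mxE mulrC. Qed.

Lemma gradv_coord h z d i : differentiable h z ->
  gradv (fun z => h z 0 i) z d = jacv h z d 0 i.
Proof.
by move=> dh; rewrite /gradv gradx_coord// grady_coord// !dotv_col /jacv [RHS]mxE.
Qed.

(** Passing to coordinates lets every estimate be stated once, for scalar
    functions. *)
Lemma C1_coord h i : C1_vector h -> C1_scalar (fun z => h z 0 i).
Proof.
move=> [dh [cx cy]]; split=> [z|]; first exact: (diff_coord i (dh z)).1.
have Cc l (J : prodRV R n m -> 'M[R]_(l, k)) : continuous J ->
    continuous (fun z => (col i (J z))^T).
  move=> cJ z; apply/cvgrPdist_lt => e e0.
  move/cvgrPdist_lt : (cJ z) => /(_ e e0); apply: filterS => z'.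
  apply: le_lt_trans; rewrite [leLHS]/Num.Def.normr/= mx_normrE.
  apply: bigmax_le => // -[i' j] _; rewrite !mxE/=.
  rewrite [leRHS]/Num.Def.normr/= mx_normrE.
  have := le_bigmax 0 (fun ij => `|(J z - J z') ij.1 ij.2|) (j, i).
  by rewrite /= !mxE.
split.
  rewrite (_ : gradx _ = fun z => (col i (jacx h z))^T); first exact: Cc.
  by apply/funext => z; exact: gradx_coord.
rewrite (_ : grady _ = fun z => (col i (jacy h z))^T); first exact: Cc.
by apply/funext => z; exact: grady_coord.
Qed.

Lemma mulmx_jacx h z (l : 'rV[R]_k) : differentiable h z ->
  l *m (jacx h z)^T = \sum_i l 0 i *: gradx (fun z => h z 0 i) z.
Proof.
move=> dh; rewrite mulmx_sum_row; apply: eq_bigr => i _.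
by rewrite gradx_coord// tr_col.
Qed.

Lemma mulmx_jacy h z (l : 'rV[R]_k) : differentiable h z ->
  l *m (jacy h z)^T = \sum_i l 0 i *: grady (fun z => h z 0 i) z.
Proof.
move=> dh; rewrite mulmx_sum_row; apply: eq_bigr => i _.
by rewrite grady_coord// tr_col.
Qed.

End Coordinate.

(** * Estimates near a point and along rays *)

Lemma forall_radius (R : realType) (I : finType) (P : I -> R -> Prop) :
  (forall i r s, s <= r -> P i r -> P i s) ->
  (forall i, exists2 r, 0 < r & P i r) ->
  exists2 r, 0 < r & forall i, P i r.
Proof.
move=> P_le Pex.
have /choice[r rP] : forall i, exists r, 0 < r /\ P i r.
  by move=> i; have [r r0 Pr] := Pex i; exists r.
exists (\big[Num.min/1]_i r i) => [|i].
  by apply: lt_bigmin => // i _; exact: (rP i).1.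
exact: P_le (bigmin_le _ _ _) (rP i).2.
Qed.

Section SmallParameters.
Context {R : realType}.

Lemma near0_forall (I : finType) (P : I -> R -> Prop) :
  (forall i, \forall t \near 0^'+, P i t) ->
  \forall t \near 0^'+, forall i, P i t.
Proof. exact: filter_forall. Qed.

Lemma near0_mul_lt (K b : R) : 0 < b -> \forall t \near 0^'+, t * K < b.
Proof.
move=> b0; have K0 : 0 < 1 + `|K| by rewrite ltr_pwDl.
near=> t; have t0 : 0 < t by near: t; exact: nbhs_right_gt.
have : t * (1 + `|K|) < b.
  rewrite -ltr_pdivlMr//; near: t; apply: nbhs_right_lt; exact: divr_gt0.
have : t * K <= t * `|K| by rewrite ler_pM2l// ler_norm.
by rewrite mulrDr mulr1; lra.
Unshelve. all: by end_near. Qed.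

Lemma ge0_of_perturbation (x k : R) :
  (forall eps, 0 < eps -> 0 <= x + eps * k) -> 0 <= x.
Proof.
move=> xk; rewrite leNgt; apply/negP => x0.
have : \forall t \near (0 : R)^'+, 0 < t /\ t * k < - x.
  by apply: filterI; [exact: nbhs_right_gt|apply: near0_mul_lt; rewrite oppr_gt0].
by move=> /filter_ex[t [/xk]]; lra.
Qed.

End SmallParameters.

Section Rays.
Context {R : realType} {n m : nat}.
Implicit Types (h : prodRV R n m -> R) (z a : prodRV R n m).

Lemma C1_expansion h z0 a eps : C1_scalar h -> 0 < eps ->
  \forall t \near 0^'+, `|h (z0 + t *: a) - h z0 - t * gradv h z0 a| <= eps * t.
Proof.
move=> hC1 e0; pose K := 1 + `|a|.
have K0 : 0 < K by rewrite ltr_pwDl.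
have [r r0 hr] := C1_strict_diff z0 hC1 (divr_gt0 e0 K0).
near=> t.
have t0 : 0 < t by near: t; exact: nbhs_right_gt.
have := hr z0 (t *: a); rewrite subrr normr0 => /(_ r0).
rewrite addrAC subrr add0r gradvZ normrZ gtr0_norm// => /(_ _)/wrap[|le_a].
  rewrite (le_lt_trans (_ : _ <= t * K))//; first by rewrite ler_pM2l// lerDr.
  rewrite -ltr_pdivlMr//; near: t; apply: nbhs_right_lt; exact: divr_gt0.
rewrite (le_trans le_a)// mulrCA mulrC ler_pM2r// mulrAC ler_pdivrMr// ler_pM2l//.
by rewrite lerDr.
Unshelve. all: by end_near. Qed.

(** A function that is negative at [z0] stays so along a short ray, hence only
    the case of an active constraint needs the slope [b]. *)
Lemma near0_ray_le h z0 a b :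
  C1_scalar h -> h z0 <= 0 -> (h z0 = 0 -> gradv h z0 a < b) ->
  \forall t \near 0^'+, h (z0 + t *: a) <= t * b.
Proof.
move=> hC1; rewrite le_eqVlt => /predU1P[h0 /(_ h0) ab|h0 _]; near=> t.
- have t0 : 0 < t by near: t; exact: nbhs_right_gt.
  have : `|h (z0 + t *: a) - h z0 - t * gradv h z0 a| <= (b - gradv h z0 a) * t.
    by near: t; apply: C1_expansion; rewrite ?subr_gt0.
  rewrite ler_norml => /andP[_]; lra.
have t0 : 0 < t by near: t; exact: nbhs_right_gt.
have : `|h (z0 + t *: a) - h z0 - t * gradv h z0 a| <= 1 * t.
  by near: t; apply: C1_expansion.
have : t * (gradv h z0 a + 1 - b) < - h z0.
  by near: t; apply: near0_mul_lt; rewrite oppr_gt0.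
rewrite ler_norml => ? /andP[_]; lra.
Unshelve. all: by end_near. Qed.

(** The base point [z] moves in a whole neighbourhood of [z0]: what has to be
    kept feasible later is not [z0] but a near-minimiser of a perturbed
    lower-level problem. *)
Lemma inward_shift_le0 h z0 a : C1_scalar h -> h z0 <= 0 ->
  (h z0 = 0 -> gradv h z0 a < 0) ->
  exists2 r, 0 < r & forall z t, `|z - z0| < r -> `|z + t *: a - z0| < r ->
    0 <= t -> h z <= 0 -> h (z + t *: a) <= 0.
Proof.
move=> hC1; rewrite le_eqVlt => /predU1P[h0 /(_ h0) ga|h0 _].
  pose K := 1 + `|a|.
  have K0 : 0 < K by rewrite ltr_pwDl.
  have e0 : 0 < - gradv h z0 a / K by rewrite divr_gt0// oppr_gt0.
  have [r r0 hr] := C1_strict_diff z0 hC1 e0.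
  exists r => // z t zr zar t0 hz.
  have := hr z (t *: a) zr zar; rewrite ler_norml => /andP[_].
  rewrite gradvZ normrZ ger0_norm// => le_a.
  have : - gradv h z0 a / K * (t * `|a|) <= t * - gradv h z0 a.
    rewrite mulrCA ler_wpM2l// mulrAC ler_pdivrMr// ler_pM2l ?oppr_gt0//.
    by rewrite lerDr.
  lra.
have : \forall z \near z0, h z < 0.
  have hc : h @ z0 --> h z0 := differentiable_continuous (hC1.1 z0).
  exact: (@cvgr_lt _ _ _ _ h (h z0) hc 0 h0).
move=> /nbhs_ballP[r /= r0 hr]; exists r => // z t _ zar _ _; apply/ltW/hr.
by rewrite -ball_normE /ball_/= distrC.
Qed.

End Rays.

(** * The regularised lower-level problem *)

Lemma cvg_comp_pair (T : Type) (F : set_system T) (V W U : topologicalType)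
    (h : V * W -> U) (a : T -> V) (b : T -> W) (a0 : V) (b0 : W) :
  Filter F -> continuous h -> a @ F --> a0 -> b @ F --> b0 ->
  (fun x => h (a x, b x)) @ F --> h (a0, b0).
Proof.
move=> FF hc aa bb.
by apply: (@continuous_cvg _ _ _ F FF (fun x => (a x, b x)) h (a0, b0) (hc _));
   exact: cvg_pair.
Qed.

Lemma lower_feasible_self (R : realType) n m p (g : prodRV R n m -> 'rV[R]_p) z :
  nonposv (g z) -> lower_feasible g z.1 z.2.
Proof. by case: z. Qed.

Section LowerLevel.
Context {R : realType} {n m p : nat}.
Variables (f : prodRV R n m -> R) (g : prodRV R n m -> 'rV[R]_p).
Variables (rho gamma : R).

Definition prox_obj (z : prodRV R n m) (w : 'rV[R]_m) : R :=
  f (z.1, w) + (2 * gamma)^-1 * enorm (w - z.2) ^+ 2.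

Lemma prox_obj_self z : prox_obj z z.2 = f z.
Proof.
by rewrite /prox_obj subrr enorm_sqr dotv0l mulr0 addr0; case: z.
Qed.

Lemma moreau_env_le z w : lower_feasible g z.1 w ->
  (moreau_env f g gamma z <= (prox_obj z w)%:E)%E.
Proof. by move=> gw; apply: ereal_inf_lbound; exists w. Qed.

Lemma le_moreau_env z (x : \bar R) :
  (forall w, lower_feasible g z.1 w -> (x <= (prox_obj z w)%:E)%E) ->
  (x <= moreau_env f g gamma z)%E.
Proof. by move=> xw; apply: le_ereal_inf_tmp => _ [w gw <-]; exact: xw. Qed.

Hypothesis f_wconvex : forall x, weakly_convex rho (fun y => f (x, y)).
Hypothesis g_qconvex : forall x i, quasi_convex (fun y => g (x, y) 0 i).
Hypothesis gamma_gt0 : 0 < gamma.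
Hypothesis gamma_lt : 0 < rho -> gamma < 1 / (2 * rho).

(** The feasible set is an intersection of sublevel sets of quasi-convex
    functions. *)
Lemma lower_feasible_convex x t (y w : 'rV[R]_m) : 0 <= t <= 1 ->
  lower_feasible g x y -> lower_feasible g x w ->
  lower_feasible g x (t *: y + (1 - t) *: w).
Proof.
move=> /andP[t0 t1] gy gw i.
have := @g_qconvex x i 0 y w (Itv01 t0 t1).
by rewrite !inE; apply; [exact: gy|exact: gw].
Qed.

(** The modulus of strong convexity of [prox_obj z]: the weight
    [1 / (2 gamma)] of the proximal term exceeds the [rho / 2] that is needed
    to make [f] convex. *)
Lemma prox_modulus_gt0 : 0 < (2 * gamma)^-1 - rho / 2.
Proof.
have [rho0 _] := f_wconvex 0.
have [->|rho_neq0] := eqVneq rho 0; first by rewrite mul0r subr0 invr_gt0 mulr_gt0.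
have rho_gt0 : 0 < rho by rewrite lt_neqAle eq_sym rho_neq0.
have := gamma_lt rho_gt0; rewrite ltr_pdivlMr ?mulr_gt0// => gr.
rewrite subr_gt0 -[ltRHS]mul1r ltr_pdivlMr ?mulr_gt0//.
have := mulr_gt0 gamma_gt0 rho_gt0; lra.
Qed.

Lemma prox_obj_strongly_convex z t y w : 0 <= t <= 1 ->
  prox_obj z (t *: y + (1 - t) *: w) <= t * prox_obj z y + (1 - t) * prox_obj z w
    - ((2 * gamma)^-1 - rho / 2) * (t * (1 - t) * enorm (y - w) ^+ 2).
Proof.
move=> /andP[t0 t1].
have := (f_wconvex z.1).2 (Itv01 t0 t1) y w (in_setT _) (in_setT _).
rewrite convRE /conv/= /unstable.onem /prox_obj !enorm_sqr.
rewrite !(dotvDl, dotvDr, dotvNl, dotvNr, dotvZl, dotvZr).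
rewrite (dotvC w y) (dotvC z.2 y) (dotvC z.2 w).
move: (f _) (f _) (f _) => a b c.
move: (dotv _ _) (dotv _ _) (dotv _ _) (dotv _ _) (dotv _ _) (dotv _ _).
move=> A B C D E F.
move: (2 * gamma)^-1 (rho / 2) => k r H.
lra.
Qed.

(** A second minimiser would, by strong convexity, make the midpoint a
    strictly better feasible point. *)
Lemma prox_obj_unique z w :
  ((f z)%:E <= moreau_env f g gamma z)%E -> lower_feasible g z.1 z.2 ->
  lower_feasible g z.1 w -> prox_obj z w <= f z -> w = z.2.
Proof.
move=> fz gz gw wz; apply/eqP; rewrite -subr_eq0; apply/eqP/dotvv_eq0/le_anti.
rewrite dotvv_ge0 andbT -enorm_sqr.
have half01 : 0 <= (2^-1 : R) <= 1 by apply/andP; split; lra.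
have := prox_obj_strongly_convex z w z.2 half01.
have := lower_feasible_convex half01 gw gz => /moreau_env_le /(le_trans fz).
rewrite lee_fin prox_obj_self; move: (prox_obj z (_ + _)) => a.
move: (enorm _ ^+ 2) prox_modulus_gt0 => e c0 za az.
have : ((2 * gamma)^-1 - rho / 2) * e <= 0 by lra.
by rewrite pmulr_rle0.
Qed.

Hypothesis f_cont : continuous f.
Hypothesis g_cont : forall i, continuous (fun z => g z 0 i).

Lemma continuous_prox_obj (z0 : prodRV R n m) (w0 : 'rV[R]_m) :
  (fun wz : 'rV[R]_m * prodRV R n m => prox_obj wz.2 wz.1) @ (w0, z0) -->
  prox_obj z0 w0.
Proof.
have cw : (fun wz : 'rV[R]_m * prodRV R n m => wz.1) @ (w0, z0) --> w0.
  exact: cvg_fst.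
have cz : (fun wz : 'rV[R]_m * prodRV R n m => wz.2) @ (w0, z0) --> z0.
  exact: cvg_snd.
have cx : (fun wz : 'rV[R]_m * prodRV R n m => wz.2.1) @ (w0, z0) --> z0.1.
  exact: (cvg_comp _ _ cz cvg_fst).
have cy : (fun wz : 'rV[R]_m * prodRV R n m => wz.2.2) @ (w0, z0) --> z0.2.
  exact: (cvg_comp _ _ cz cvg_snd).
have cf : (fun wz : 'rV[R]_m * prodRV R n m => f (wz.2.1, wz.1)) @ (w0, z0) -->
    f (z0.1, w0).
  exact: cvg_comp_pair.
have cd : (fun wz : 'rV[R]_m * prodRV R n m =>
    dotv (wz.1 - wz.2.2) (wz.1 - wz.2.2)) @ (w0, z0) -->
    dotv (w0 - z0.2) (w0 - z0.2).
  apply: (@continuous_cvg _ _ _ _ _ _ (fun a => dotv a a) (w0 - z0.2)).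
    exact: continuous_dotvv.
  exact: cvgB.
rewrite /prox_obj enorm_sqr.
under eq_fun do rewrite enorm_sqr.
apply: cvgD; first exact: cf.
by apply: cvgM; [exact: cvg_cst|exact: cd].
Qed.

(** Near-minimisers of the regularised problem at [z] tend to [z0.2] as [z]
    tends to [z0]. If [w] is far away, the segment from the feasible point
    [z.2] to [w] meets the sphere of radius [e] about [z0.2] in a point that,
    by convexity, is feasible and nearly optimal as well. On this sphere,
    which is compact, every point is infeasible for [z0] or strictly worse
    than [z0.2], and both properties persist uniformly under small changes of
    [z]. *)
Lemma prox_stable z0 e :
  ((f z0)%:E <= moreau_env f g gamma z0)%E -> lower_feasible g z0.1 z0.2 ->
  0 < e ->
  exists2 r, 0 < r & forall z w, `|z - z0| < r -> lower_feasible g z.1 z.2 ->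
    lower_feasible g z.1 w -> prox_obj z w <= f z + r -> `|w - z0.2| < e.
Proof.
move=> fz0 gz0 e0.
pose K : set 'rV[R]_m := [set w | `|w - z0.2| = e].
have cK : continuous (fun w : 'rV[R]_m => `|w - z0.2|).
  by move=> w; exact: (cvg_norm (cvgB cvg_id (cvg_cst _))).
have Kcompact : compact K.
  apply: bounded_closed_compact.
    exists (`|z0.2| + e); split => [|M ltM w /= Kw]; first exact: num_real.
    rewrite -(subrK z0.2 w) (le_trans (ler_normD _ _))// Kw.
    by rewrite addrC ltW.
  rewrite (_ : K = (fun w => `|w - z0.2|) @^-1` [set e])//.
  by apply: closed_comp => [w _|]; [exact: cK|exact: closed_eq].
have /compact_near_coveringP Kcover := Kcompact.
(* The second component of the index is the tolerance in the objective. *)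
pose P (zs : prodRV R n m * R) (w : 'rV[R]_m) :=
  lower_feasible g zs.1.1 w -> f zs.1 + zs.2 < prox_obj zs.1 w.
have : \forall zs \near (z0, 0 : R), K `<=` P zs.
  apply: (Kcover _ (nbhs (z0, 0 : R)) P) => w Kw.
  have cw : (fun x : 'rV[R]_m * (prodRV R n m * R) => x.1) @ (w, (z0, 0 : R)) --> w.
    exact: cvg_fst.
  have czs : (fun x : 'rV[R]_m * (prodRV R n m * R) => x.2) @ (w, (z0, 0 : R))
      --> (z0, 0 : R) by exact: cvg_snd.
  have cz : (fun x : 'rV[R]_m * (prodRV R n m * R) => x.2.1) @ (w, (z0, 0 : R))
      --> z0 by exact: (cvg_comp _ _ czs cvg_fst).
  have cs : (fun x : 'rV[R]_m * (prodRV R n m * R) => x.2.2) @ (w, (z0, 0 : R))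
      --> (0 : R) by exact: (cvg_comp _ _ czs cvg_snd).
  have cx : (fun x : 'rV[R]_m * (prodRV R n m * R) => x.2.1.1) @ (w, (z0, 0 : R))
      --> z0.1 by exact: (cvg_comp _ _ cz cvg_fst).
  have [gw|] := pselect (lower_feasible g z0.1 w).
    have lt_w : 0 < prox_obj z0 w - (f z0 + 0).
      rewrite addr0 subr_gt0 ltNge; apply/negP => /(prox_obj_unique fz0 gz0 gw).
      by move=> Ew; move: Kw; rewrite /K/= Ew subrr normr0 => E; rewrite E ltxx in e0.
    have : (fun x : 'rV[R]_m * (prodRV R n m * R) =>
        prox_obj x.2.1 x.1 - (f x.2.1 + x.2.2)) @ (w, (z0, 0 : R)) -->
        prox_obj z0 w - (f z0 + 0).
      apply: cvgB.
        apply: (@cvg_comp_pair _ _ _ _ _ (fun wz => prox_obj wz.2 wz.1)) => //.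
        by case=> w' z'; exact: continuous_prox_obj.
      by apply: cvgD cs; apply: (@continuous_cvg _ _ _ _ _ _ f z0) => //; exact: f_cont.
    move/cvgr_gt => /(_ _ lt_w); apply: filterS => x /=.
    by rewrite subr_gt0 => + _.
  move=> /existsNP[i /negP]; rewrite -ltNge => gi.
  have : (fun x : 'rV[R]_m * (prodRV R n m * R) => g (x.2.1.1, x.1) 0 i)
      @ (w, (z0, 0 : R)) --> g (z0.1, w) 0 i.
    exact: (@cvg_comp_pair _ _ _ _ _ (fun z => g z 0 i)).
  move/cvgr_gt => /(_ _ gi); apply: filterS => x /= gx /(_ i).
  by rewrite leNgt gx.
move=> /nbhs_ballP[r /= r0 rP].
pose s := Num.min (r / 2) (e / 2).
have s0 : 0 < s by rewrite lt_min !divr_gt0.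
have sr : s < r.
  by rewrite (le_lt_trans (_ : _ <= r / 2)) ?ge_min ?lexx// ltr_pdivrMr// ltr_pMr ?ltr1n.
have se : s < e.
  rewrite (le_lt_trans (_ : _ <= e / 2)) ?ge_min ?lexx ?orbT//.
  by rewrite ltr_pdivrMr// ltr_pMr ?ltr1n.
exists s => // z w zz0 gz gw wz; rewrite ltNge; apply/negP => ew.
pose h (t : R) := `|t *: w + (1 - t) *: z.2 - z0.2|.
have hc : continuous h.
  move=> t; exact: (cvg_norm (cvgB (cvgD (cvgZr_tmp cvg_id)
    (cvgZr_tmp (cvgB (cvg_cst _) cvg_id))) (cvg_cst _))).
have h0 : h 0 <= e.
  rewrite /h scale0r add0r subr0 scale1r (le_trans (prod_norm_snd (z - z0)))//.
  by rewrite ltW// (lt_trans zz0).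
have h1 : e <= h 1 by rewrite /h subrr scale0r addr0 scale1r.
have [|t] := @IVT R h 0 1 e ler01 (continuous_subspaceT hc).
  by rewrite ge_min h0 le_max h1 orbT.
rewrite in_itv/= => t01 ht.
have := rP (z, s) _ (t *: w + (1 - t) *: z.2) ht.
have := prox_obj_strongly_convex z w z.2 t01.
have gt := lower_feasible_convex t01 gw gz.
rewrite /P/= => sc /(_ _ gt); rewrite prox_obj_self in sc.
case/andP: t01 => t0 t1.
have tw : t * prox_obj z w <= t * (f z + s) by rewrite ler_wpM2l.
have ts : t * s <= s by rewrite ler_piMl// ltW.
have : 0 <= ((2 * gamma)^-1 - rho / 2) * (t * (1 - t) * enorm (w - z.2) ^+ 2).
  apply: mulr_ge0; first exact: ltW prox_modulus_gt0.
  by apply: mulr_ge0 (sqr_ge0 _); apply: mulr_ge0; rewrite ?subr_ge0.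
move=> c0 /(_ _)/wrap[|]; last by lra.
split => /=; rewrite -ball_normE /ball_/=; first by rewrite distrC (lt_trans zz0).
by rewrite sub0r normrN gtr0_norm.
Qed.

End LowerLevel.

(** * First-order lower bounds for the Moreau envelope *)

Section MoreauShift.
Context {R : realType} {n m p : nat}.
Variables (f : prodRV R n m -> R) (g : prodRV R n m -> 'rV[R]_p) (gamma : R).
Variables (z0 e : prodRV R n m) (xi : 'rV[R]_m).

Hypothesis f_C1 : C1_scalar f.
Hypothesis g_C1 : C1_vector g.
Hypothesis gamma_gt0 : 0 < gamma.
Hypothesis g_z0 : nonposv (g z0).
Hypothesis xi_inward : forall i, g z0 0 i = 0 ->
  gradv (fun z => g z 0 i) z0 (- e.1, xi) < 0.

(** The mechanism behind all lower bounds for the envelope. Moving the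
    parameter back from [z + t *: e] to [z] amounts, for a lower-level point
    [w], to the displacement [t *: (- e.1, xi)] of [(x, w)]; if this direction
    points strictly into the active constraints, then feasibility survives,
    and the objective grows by its first-order variation. The proximal term
    contributes only [o(t)] because [w - z.2] is small. *)
Lemma prox_obj_shift eps : 0 < eps ->
  exists2 r, 0 < r & forall z t w, `|z - z0| < r -> 0 <= t -> t < r ->
    `|w - z0.2| < r -> lower_feasible g (z + t *: e).1 w ->
    lower_feasible g z.1 (w + t *: xi) /\
    prox_obj f gamma z (w + t *: xi) <=
      prox_obj f gamma (z + t *: e) w + t * (gradv f z0 (- e.1, xi) + eps).
Proof.
move=> eps0; pose a : prodRV R n m := (- e.1, xi).
have [rg rg0 hg] : exists2 r, 0 < r & forall i z t, `|z - z0| < r ->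
    `|z + t *: a - z0| < r -> 0 <= t -> g z 0 i <= 0 ->
    g (z + t *: a) 0 i <= 0.
  apply: forall_radius => [i r s sr hr z t zs zas|i].
    by apply: hr; apply: lt_le_trans sr.
  exact: inward_shift_le0 (C1_coord i g_C1) (g_z0 i) (xi_inward (i := i)).
pose K := 1 + `|a|; have K0 : 0 < K by rewrite ltr_pwDl.
have [rf rf0 hf] := C1_strict_diff z0 f_C1 (divr_gt0 (divr_gt0 eps0 (ltr0Sn R 1)) K0).
pose Q := 1 + (2 * gamma)^-1 * (m%:R * (`|xi + e.2| * 4)).
have Q0 : 0 < Q.
  by rewrite ltr_pwDl// mulr_ge0 ?invr_ge0 ?mulr_ge0// ltW.
(* The three bounds serve feasibility, the linearisation of [f] and the
   quadratic term; [L] absorbs the displacements along [e] and [xi]. *)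
pose r1 := Num.min (Num.min rg rf) (eps / 2 / Q).
have r10 : 0 < r1 by rewrite !lt_min rg0 rf0 divr_gt0// divr_gt0.
pose L := 1 + `|e| + `|xi|.
have L0 : 0 < L by rewrite ltr_pwDl// ltr_pwDl.
exists (r1 / L); first exact: divr_gt0.
move=> z t w zr t0 tr wr gw.
have rL : r1 / L * L = r1 by rewrite divfK ?gt_eqF.
have rLE : r1 / L + r1 / L * `|e| + r1 / L * `|xi| = r1.
  by rewrite -[RHS]rL /L !mulrDr mulr1.
have rL0 : 0 < r1 / L by exact: divr_gt0.
have re0 : 0 <= r1 / L * `|e| by rewrite mulr_ge0// ltW.
have rxi0 : 0 <= r1 / L * `|xi| by rewrite mulr_ge0// ltW.
have te : t * `|e| <= r1 / L * `|e| by rewrite ler_wpM2r// ltW.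
have txi : t * `|xi| <= r1 / L * `|xi| by rewrite ler_wpM2r// ltW.
pose y : prodRV R n m := ((z + t *: e).1, w).
have yE : y + t *: a = (z.1, w + t *: xi).
  congr pair; rewrite /y/a/=; case: z e {zr gw y te re0 rLE rL L L0 rL0 rxi0 txi tr wr} => [z1 z2] [e1 e2] /=.
  by rewrite scalerN addrK.
have z1r := le_lt_trans (prod_norm_fst (z - z0)) zr.
have z2r := le_lt_trans (prod_norm_snd (z - z0)) zr.
have yr : `|y - z0| < r1.
  rewrite prod_normE gt_max; apply/andP; split => /=; last lra.
  rewrite addrAC (le_lt_trans (ler_normD _ _))// normrZ ger0_norm//.
  have := ler_wpM2l t0 (prod_norm_fst e); rewrite /= in z1r *; lra.
have yar : `|y + t *: a - z0| < r1.
  rewrite yE prod_normE gt_max; apply/andP; split => /=.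
    rewrite /= in z1r *; lra.
  rewrite addrAC (le_lt_trans (ler_normD _ _))// normrZ ger0_norm//; lra.
have r1g : r1 <= rg by rewrite /r1 !ge_min lexx.
have r1f : r1 <= rf by rewrite /r1 !ge_min lexx orbT.
have r1Q : r1 <= eps / 2 / Q by rewrite /r1 !ge_min lexx orbT.
split => [i|].
  by have := hg i y t (lt_le_trans yr r1g) (lt_le_trans yar r1g) t0 (gw i); rewrite yE.
have := hf y (t *: a) (lt_le_trans yr r1f) (lt_le_trans yar r1f).
rewrite ler_norml => /andP[_]; rewrite gradvZ normrZ ger0_norm// yE => fle.
have aK : eps / 2 / K * (t * `|a|) <= t * (eps / 2).
  rewrite mulrCA ler_wpM2l// mulrAC ler_pdivrMr// ler_wpM2l ?lerDr//.
  by rewrite divr_ge0// ltW.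
have := enorm_sqr_diff_le (w - z.2) (t *: xi) (t *: e.2).
rewrite addrAC -[w - z.2 - _]addrA -opprD -scalerDr !normrZ ger0_norm// => qle.
have wz : `|w - z.2| < 2 * (r1 / L).
  rewrite -(subrK z0.2 w) -addrA (le_lt_trans (ler_normD _ _))//.
  rewrite (distrC z0.2) /= in z2r *; lra.
have te2 := ler_wpM2l t0 (prod_norm_snd e).
have dle : 2 * `|w - z.2| + t * `|xi| + t * `|e.2| <= 4 * r1 by lra.
have {}qle : (2 * gamma)^-1 * (enorm (w + t *: xi - z.2) ^+ 2 -
    enorm (w - (z.2 + t *: e.2)) ^+ 2) <= t * (eps / 2).
  have gV0 : 0 <= (2 * gamma)^-1 by rewrite invr_ge0 mulr_ge0// ltW.
  rewrite (le_trans (ler_wpM2l gV0 qle))//.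
  have : (2 * gamma)^-1 * (m%:R * (t * `|xi + e.2| *
      (2 * `|w - z.2| + t * `|xi| + t * `|e.2|))) <=
      (2 * gamma)^-1 * (m%:R * (t * `|xi + e.2| * (4 * r1))).
    by rewrite !ler_wpM2l// mulr_ge0.
  move=> /le_trans; apply.
  rewrite [leLHS](_ : _ = t * (r1 * (Q - 1))); last by rewrite /Q; ring.
  rewrite ler_wpM2l// (le_trans (_ : _ <= r1 * Q))//.
    by rewrite ler_pM2l// gerBl.
  by rewrite -ler_pdivlMr.
rewrite /prox_obj /= in fle *; rewrite -/a.
have -> : f (z.1, w + t *: xi) + (2 * gamma)^-1 * enorm (w + t *: xi - z.2) ^+ 2 =
  f (z.1, w + t *: xi) + (2 * gamma)^-1 * enorm (w - (z.2 + t *: e.2)) ^+ 2 +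
  (2 * gamma)^-1 * (enorm (w + t *: xi - z.2) ^+ 2 -
    enorm (w - (z.2 + t *: e.2)) ^+ 2) by ring.
rewrite /y/= in fle; lra.
Qed.

End MoreauShift.

(** * First-order consequences of directional partial calmness *)

(** An upper limit is approached only along some [t], which may be chosen
    within any neighbourhood of [0] on the right. *)
Lemma upper_dini_frequently (R : realType) n m (psi : prodRV R n m -> \bar R)
    z d (a x y : R) (P : R -> Prop) :
  psi z = a%:E -> (x%:E <= upper_dini psi z d)%E -> y < x ->
  (\forall t \near 0^'+, P t) ->
  exists t, [/\ 0 < t, P t & ((a + t * y)%:E <= psi (z + t *: d)%R)%E].
Proof.
move=> psiz xle yx nearP.
pose V := [set t : R | 0 < t /\ P t].
have nV : \forall t \near 0^'+, V t by apply: filterI nearP; exact: nbhs_right_gt.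
have : (y%:E < ereal_sup [set ((psi (z + t *: d)%R - psi z) * (t^-1)%:E)%E |
    t in V])%E.
  have yx' : (y%:E < x%:E)%E by rewrite lte_fin.
  apply: lt_le_trans yx' (le_trans xle _).
  by apply: ereal_inf_lbound; exists V.
move=> /ereal_sup_gt[_ [t [t0 Pt] <-]] yt; exists t; split => //.
move: yt; rewrite psiz; case: (psi _) => [r||] /=.
- rewrite -EFinD -EFinM !lee_fin lte_fin ltr_pdivlMr// => yt; lra.
- by rewrite leey.
- by rewrite addNye gt0_mulNye ?lte_fin ?invr_gt0.
Qed.

(** Real arithmetic for [calm_first_order]. Here [x] is the error in the
    linearisation of [f] along a step of length [t], [a] its slope along the
    additional direction, and [k] the slope of the cost of shifting a
    near-minimiser; the sum bounds the value gap [f - v_gamma]. *)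
Lemma gap_bound (R : realType) (x t s eps a k : R) :
  0 < t -> 0 < s -> s < 1 -> 0 < eps -> `|x| <= t * eps ->
  `|x + (t * s * (a + k + eps) + t * eps)| <= t * (`|a| + `|k| + 3 * eps).
Proof.
move=> t0 s0 s1 eps0 xle.
have ts0 : 0 < t * s by rewrite mulr_gt0.
have akle : `|t * s * (a + k + eps)| <= t * (`|a| + `|k| + eps).
  rewrite normrM (gtr0_norm ts0) ler_pM ?(ltW ts0)//.
    by rewrite ger_pMr// ltW.
  rewrite (le_trans (ler_normD _ _))// (gtr0_norm eps0) lerD2r.
  exact: ler_normD.
have teps0 : 0 < t * eps by rewrite mulr_gt0.
rewrite (le_trans (ler_normD _ _))// (le_trans (lerD xle (ler_normD _ _)))//.
rewrite (gtr0_norm teps0); lra.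
Qed.

Lemma gap_rescaled (R : realType) (t s c k eps rho A N Fz Fd Fe fz fe x : R) q :
  0 < t -> 0 < s -> s < 1 -> 0 < eps -> 0 < rho -> Fd <= 0 ->
  Fz - t * (Fd + s * Fe) <= t * eps -> x <= t * eps ->
  A = x + (t * s * (fe + k + eps) + t * eps) ->
  N <= A + q%:R * (t * (s * c + eps)) -> 0 <= Fz + rho * N ->
  0 <= s * (Fe + rho * (fe + k + q%:R * c)) + eps * (1 + rho * (3 + q%:R)).
Proof.
move=> t0 s0 s1 eps0 rho0 Fd0 Fzle xle -> Nle.
have tse : t * s * eps <= t * eps.
  by rewrite ler_pM2r// ger_pMr// ltW.
have tFd : t * Fd <= 0 by rewrite pmulr_rle0.
have {}Nle : N <= t * s * (fe + k) + 3 * (t * eps) + q%:R * (t * (s * c + eps)).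
  by lra.
rewrite -(ler_pM2l rho0) in Nle => NF.
by rewrite -(pmulr_rge0 _ t0); lra.
Qed.

Section DirectionalCalmness.
Context {R : realType} {n m p q : nat}.
Variables (F f : prodRV R n m -> R).
Variables (g : prodRV R n m -> 'rV[R]_p) (G : prodRV R n m -> 'rV[R]_q).
Variables (gamma : R) (z0 d : prodRV R n m).

Hypothesis F_C1 : C1_scalar F.
Hypothesis f_C1 : C1_scalar f.
Hypothesis g_C1 : C1_vector g.
Hypothesis G_C1 : C1_vector G.
Hypothesis gamma_gt0 : 0 < gamma.
Hypothesis g_z0 : nonposv (g z0).
Hypothesis G_z0 : nonposv (G z0).
Hypothesis env_z0 : moreau_env f g gamma z0 = (f z0)%:E.
Hypothesis stable : forall e : R, 0 < e ->
  exists2 r, 0 < r & forall z w, `|z - z0| < r -> lower_feasible g z.1 z.2 ->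
    lower_feasible g z.1 w -> prox_obj f gamma z w <= f z + r ->
    `|w - z0.2| < e.
Hypothesis crit : critical_cone F f g G gamma z0 d.

(** Constraints that are active at [z0] but strictly decrease along [d] stay
    decreasing along [d + s *: e] for small [s]; only those with zero slope
    along [d] constrain [e]. This is where the multipliers acquire their
    orthogonality to the directional derivatives. *)
Lemma near0_direction e c :
  0 < c ->
  (forall i, g z0 0 i = 0 -> gradv (fun z => g z 0 i) z0 d = 0 ->
     gradv (fun z => g z 0 i) z0 e < 0) ->
  (forall i, G z0 0 i = 0 -> gradv (fun z => G z 0 i) z0 d = 0 ->
     gradv (fun z => G z 0 i) z0 e <= c) ->
  \forall s \near 0^'+,
    (forall i, g z0 0 i = 0 -> gradv (fun z => g z 0 i) z0 (d + s *: e) < 0) /\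
    (forall i, G z0 0 i = 0 -> gradv (fun z => G z 0 i) z0 (d + s *: e) <= s * c).
Proof.
move=> c0 ge Ge; have [_ _ gd Gd] := crit.
apply: filterI; apply: near0_forall => i.
  have [gi0|gi0] := eqVneq (g z0 0 i) 0; last by near=> s => gi; rewrite gi eqxx in gi0.
  have gdi := gd i gi0; rewrite -(gradv_coord _ i (g_C1.1 z0)) in gdi.
  have [gdi0|gdi0] := eqVneq (gradv (fun z => g z 0 i) z0 d) 0.
    near=> s => _; have s0 : 0 < s by near: s; exact: nbhs_right_gt.
    by rewrite gradvD gradvZ gdi0 add0r pmulr_rlt0// ge.
  near=> s => _; rewrite gradvD gradvZ addrC -ltrBrDr sub0r; near: s; apply: near0_mul_lt.
  by rewrite oppr_gt0 lt_neqAle gdi0.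
have [Gi0|Gi0] := eqVneq (G z0 0 i) 0; last by near=> s => Gi; rewrite Gi eqxx in Gi0.
have Gdi := Gd i Gi0; rewrite -(gradv_coord _ i (G_C1.1 z0)) in Gdi.
have [Gdi0|Gdi0] := eqVneq (gradv (fun z => G z 0 i) z0 d) 0.
  near=> s => _; have s0 : 0 < s by near: s; exact: nbhs_right_gt.
  by rewrite gradvD gradvZ Gdi0 add0r ler_pM2l// Ge.
near=> s => _; rewrite gradvD gradvZ.
have : s * (gradv (fun z => G z 0 i) z0 e - c) < - gradv (fun z => G z 0 i) z0 d.
  by near: s; apply: near0_mul_lt; rewrite oppr_gt0 lt_neqAle Gdi0.
lra.
Unshelve. all: by end_near. Qed.

(** Directional neighbourhoods are cones (up to the bound on the norm), so
    membership of [t *: (d + s *: e)] is a condition on [s] alone; it holds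
    with room to spare at [s = 0] unless [d = 0], where it holds trivially. *)
Lemma near0_dir_nbhd e delta : 0 < delta ->
  \forall s \near 0^'+, pnorm (pnorm d *: (d + s *: e) - pnorm (d + s *: e) *: d) <=
    delta * pnorm (d + s *: e) * pnorm d.
Proof.
move=> delta0; have [->|d0] := eqVneq d 0.
  by near=> s; rewrite pnorm0 scale0r scaler0 subrr pnorm0 mulr0.
have pd0 : 0 < pnorm d.
  rewrite lt_neqAle pnorm_ge0 andbT eq_sym; apply: contra_neq d0.
  rewrite pnormE => /eqP; rewrite sqrtr_eq0 => dle; case: d dle => d1 d2 /= dle.
  have := dotvv_ge0 d1; have := dotvv_ge0 d2 => d20 d10.
  have d1E : dotv d1 d1 = 0 by lra.
  have d2E : dotv d2 d2 = 0 by lra.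
  by rewrite (dotvv_eq0 d1E) (dotvv_eq0 d2E).
have cl : (fun s : R => d + s *: e) @ (0 : R) --> d + (0 : R) *: e.
  exact: cvgD (cvg_cst _) (cvgZr_tmp cvg_id).
have cp : (fun s : R => pnorm (d + s *: e)) @ (0 : R) --> pnorm (d + (0 : R) *: e).
  apply: (@continuous_cvg _ _ _ _ _ _ (@pnorm R n m)) cl.
  exact: continuous_pnorm.
have cL : (fun s : R => pnorm (pnorm d *: (d + s *: e) - pnorm (d + s *: e) *: d))
    @ (0 : R) -->
    pnorm (pnorm d *: (d + (0 : R) *: e) - pnorm (d + (0 : R) *: e) *: d).
  apply: (@continuous_cvg _ _ _ _ _ _ (@pnorm R n m)); first exact: continuous_pnorm.
  apply: cvgB; first exact: cvgZl_tmp cl.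
  exact: cvgZr_tmp cp.
have cD : (fun s : R => delta * pnorm (d + s *: e) * pnorm d -
    pnorm (pnorm d *: (d + s *: e) - pnorm (d + s *: e) *: d)) @ (0 : R) -->
    delta * pnorm (d + (0 : R) *: e) * pnorm d -
    pnorm (pnorm d *: (d + (0 : R) *: e) - pnorm (d + (0 : R) *: e) *: d).
  exact: cvgB (cvgM (cvgM (cvg_cst delta) cp) (cvg_cst (pnorm d))) cL.
rewrite scale0r addr0 subrr pnorm0 subr0 in cD.
have D0 : 0 < delta * pnorm d * pnorm d by rewrite !mulr_gt0.
have nD : \forall s \near (0 : R), 0 < delta * pnorm (d + s *: e) * pnorm d -
    pnorm (pnorm d *: (d + s *: e) - pnorm (d + s *: e) *: d).
  exact: (@cvgr_gt _ _ _ _ _ _ cD 0 D0).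
near=> s; rewrite -subr_ge0 ltW//; near: s.
exact: (@cvg_within _ (nbhs (0 : R))) nD.
Unshelve. all: by end_near. Qed.

(** Calmness is tested at [zt = z0 + t *: (d + s *: e)] for a fixed small [s]
    and those [t] along which the critical direction [d] nearly attains the
    upper Dini derivative, so that [v_gamma (z0 + t *: d)] is at least
    [f z0 + t * gradv f z0 d - o(t)]. The step from [z0 + t *: d] to [zt] has
    length of order [t * s], and [prox_obj_shift] bounds the loss of the
    envelope on it. Hence [zt] is feasible for a perturbation of size at most
    [t * s * (gradv f z0 e + gradv f z0 (- e.1, xi) + q * c) + o(t)], while
    [F zt - F z0] is at most [t * s * gradv F z0 e + o(t)] as [d] is critical.
    Dividing by [t * s] gives the inequality. The slack [c] in the constraints
    on [G] has to be allowed since no qualification makes them strict. *)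
Lemma calm_first_order rho eps0 delta e xi c :
  0 < eps0 -> 0 < delta -> 0 < rho ->
  (forall (a : R) (b : 'rV[R]_q) (z : prodRV R n m),
      pnorm (a%:M : 'rV[R]_1, b) < eps0 ->
      lower_feasible g z.1 z.2 ->
      dir_nbhd eps0 delta d (z - z0) ->
      ((f z)%:E - moreau_env f g gamma z + a%:E <= 0)%E ->
      nonposv (G z + b) ->
      0 <= F z - F z0 + rho * pnorm (a%:M : 'rV[R]_1, b)) ->
  0 < c ->
  (forall i, g z0 0 i = 0 -> gradv (fun z => g z 0 i) z0 (- e.1, xi) < 0) ->
  (forall i, g z0 0 i = 0 -> gradv (fun z => g z 0 i) z0 d = 0 ->
     gradv (fun z => g z 0 i) z0 e < 0) ->
  (forall i, G z0 0 i = 0 -> gradv (fun z => G z 0 i) z0 d = 0 ->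
     gradv (fun z => G z 0 i) z0 e <= c) ->
  0 <= gradv F z0 e +
       rho * (gradv f z0 e + gradv f z0 (- e.1, xi) + q%:R * c).
Proof.
move=> eps00 delta0 rho0 calm c0 xi_in ge Ge.
have [fd Fd _ _] := crit.
have : \forall s \near (0 : R)^'+, [/\ 0 < s, s < 1 &
   (forall i, g z0 0 i = 0 -> gradv (fun z => g z 0 i) z0 (d + s *: e) < 0) /\
   (forall i, G z0 0 i = 0 ->
      gradv (fun z => G z 0 i) z0 (d + s *: e) <= s * c)] /\
   pnorm (pnorm d *: (d + s *: e) - pnorm (d + s *: e) *: d) <=
     delta * pnorm (d + s *: e) * pnorm d.
  apply: filterI; last exact: near0_dir_nbhd.
  near=> s; split.
  - by near: s; exact: nbhs_right_gt.
  - by near: s; exact: nbhs_right_lt.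
  - by near: s; exact: near0_direction.
move=> /filter_ex[s [[s0 s1 [ga Ga]] da]].
set a := d + s *: e in ga Ga da.
set X := (X in 0 <= X).
suff : 0 <= s * X by rewrite pmulr_rge0.
apply: (@ge0_of_perturbation R _ (1 + rho * (3 + q%:R))) => eps epsP.
pose k := gradv f z0 (- e.1, xi).
have [r1 r10 shift] := prox_obj_shift f_C1 g_C1 gamma_gt0 g_z0 xi_in epsP.
have [r2 r20 stab] := stable r10.
(* Bounds [`|A| / t] below, which makes the perturbation smaller than
   the calmness radius. *)
pose M := `|gradv f z0 e| + `|k| + 3 * eps.
have M0 : 0 <= M by rewrite !addr_ge0// mulr_ge0// ltW.
have nF := C1_expansion z0 a F_C1 epsP.
have nf := C1_expansion z0 a f_C1 epsP.
have ng : \forall t \near (0 : R)^'+, nonposv (g (z0 + t *: a)).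
  apply: near0_forall => i.
  have := near0_ray_le (C1_coord i g_C1) (g_z0 i) (ga i).
  by apply: filterS => t; rewrite mulr0.
have nG : \forall t \near (0 : R)^'+,
    forall i, G (z0 + t *: a) 0 i <= t * (s * c + eps).
  apply: near0_forall => i.
  apply: near0_ray_le (C1_coord i G_C1) (G_z0 i) _ => Gi.
  by rewrite (le_lt_trans (Ga i Gi))// ltrDl.
have n1 := near0_mul_lt `|a| r20; have n2 := near0_mul_lt `|d| r10.
have n3 : \forall t \near (0 : R)^'+, t < r1 by exact: nbhs_right_lt.
have n4 := near0_mul_lt (pnorm a) eps00; have n5 := near0_mul_lt M r20.
have n6 := near0_mul_lt (M + q%:R * (s * c + eps)) eps00.
have fd_eps : gradv f z0 d - eps < gradv f z0 d by rewrite ltrBlDr ltrDl.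
have [t [t0 [[[ta td] [tr tpa]] [[tM tN] [[gt Gt] [Ft ft]]]] envt]] :=
  upper_dini_frequently env_z0 fd fd_eps
    (filterI (filterI (filterI n1 n2) (filterI n3 n4))
      (filterI (filterI n5 n6) (filterI (filterI ng nG) (filterI nF nf)))).
rewrite /= in ta td tr tpa tM tN gt Gt Ft ft.
set zt := z0 + t *: a in gt Gt Ft ft.
have ztE : zt = z0 + t *: d + (t * s) *: e.
  by rewrite /zt /a scalerDr scalerA addrA.
have zt0 : zt - z0 = t *: a by rewrite /zt addrAC subrr add0r.
have aE h : gradv h z0 a = gradv h z0 d + s * gradv h z0 e.
  by rewrite /a gradvD gradvZ.
have ts0 : 0 < t * s by exact: mulr_gt0.
have tst : t * s <= t by rewrite ger_pMr// ltW.
(* [A] is chosen so that [f zt - A] is exactly the lower bound for the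
   envelope at [zt] that the shift from [z0 + t *: d] provides. *)
pose A := f zt - (f z0 + t * (gradv f z0 d - eps)) + t * s * (k + eps).
have AE : A = (f zt - f z0 - t * gradv f z0 a) +
    (t * s * (gradv f z0 e + k + eps) + t * eps) by rewrite /A aE; ring.
rewrite (mulrC eps) aE in Ft; rewrite (mulrC eps) in ft.
have AM : `|A| <= t * M by rewrite AE; exact: gap_bound.
have {tM} NAr2 : - A < r2.
  by rewrite (le_lt_trans _ tM)// (le_trans (ler_norm _))// normrN.
have gzt := lower_feasible_self gt.
have envA : ((f zt - A)%:E <= moreau_env f g gamma zt)%E.
  apply: le_moreau_env => w gw; rewrite lee_fin.
  have [wle|wgt] := lerP (prox_obj f gamma zt w) (f zt + r2); last first.
    by rewrite ltW// (lt_trans _ wgt)// ltrD2l.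
  have wr : `|w - z0.2| < r1.
    by apply: (stab zt) => //; rewrite zt0 normrZ gtr0_norm.
  have [] := shift (z0 + t *: d) (t * s) w _ (ltW ts0) _ wr _.
  - by rewrite addrAC subrr add0r normrZ gtr0_norm.
  - exact: le_lt_trans tst tr.
  - by rewrite -ztE.
  move=> wfeas shift_le.
  have := le_trans envt (moreau_env_le f gamma wfeas).
  rewrite lee_fin => /le_trans /(_ shift_le); rewrite -ztE -/k => V_le.
  have -> : f zt - A = f z0 + t * (gradv f z0 d - eps) - t * s * (k + eps).
    by rewrite /A; ring.
  by rewrite lerBlDr.
(* The envelope never exceeds [f] on the graph of the feasible set. *)
have A0 : 0 <= A.
  by have := le_trans envA (moreau_env_le f gamma gzt); rewrite prox_obj_self lee_fin gerBl.
pose N := pnorm ((- A)%:M : 'rV[R]_1, - posv (G zt)).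
have sce0 : 0 <= t * (s * c + eps).
  by rewrite mulr_ge0 ?ltW// addr_gt0// mulr_gt0.
have NA : N <= A + q%:R * (t * (s * c + eps)).
  rewrite (le_trans (pnorm_le_add _))//= lerD//.
    have := @enorm_le_coord R 1 (- A)%:M A A0; rewrite mul1r; apply => i.
    by rewrite ord1 mxE eqxx normrN ger0_norm.
  apply: enorm_le_coord => // i; rewrite !mxE normrN ger0_norm ?le_max ?lexx ?orbT//.
  by rewrite ge_max Gt.
have tM' : A <= t * M by rewrite (le_trans (ler_norm _)).
have := calm (- A) (- posv (G zt)) zt.
rewrite -/N => /(_ _ _ _ _ _)/wrap[|||||calmN].
- rewrite (le_lt_trans NA)// (le_lt_trans _ tN)// [t * (M + _)]mulrDr.
  by rewrite [t * (q%:R * _)]mulrCA lerD2r.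
- exact: gzt.
- rewrite zt0; split; first by rewrite pnormZ gtr0_norm.
  rewrite pnormZ gtr0_norm// scalerA mulrC -!scalerA -scalerBr pnormZ.
  by rewrite gtr0_norm// mulrCA -!mulrA ler_pM2l// mulrA.
- have : moreau_env f g gamma zt != -oo%E.
    by apply: contraTneq envA => ->; rewrite leNgt ltNyr.
  case: (moreau_env _ _ _ _) envA => [r||]//=.
    by rewrite -!EFinD !lee_fin addrAC subr_le0.
  by rewrite addeNy addNye leNye.
- by move=> i; rewrite !mxE subr_le0 le_max lexx.
exact: gap_rescaled t0 s0 s1 epsP rho0 Fd (le_trans (ler_norm _) Ft)
  (le_trans (ler_norm _) ft) AE NA calmN.
Unshelve. all: by end_near. Qed.

End DirectionalCalmness.

(** * Constraint qualifications *)

Section ConstraintQualification.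
Context {R : realType} {n m p : nat}.
Variables (g : prodRV R n m -> 'rV[R]_p) (z0 : prodRV R n m).

(** The linearised system being solvable for [u] and for [- u], a multiplier
    [l] that annihilates [jacy g z0] must annihilate [u *m jacx g z0] as well,
    and then it is orthogonal to the direction in which FOSCMS forces
    [l = 0]. *)
Lemma FOSCMS_MFCQ (u : 'rV[R]_n) :
  (forall a : R, linearized_dirs g z0 (a *: u) !=set0) ->
  (forall (a : R) (v' : 'rV[R]_m), (a, v') != 0 ->
     linearized_dirs g z0 (a *: u) v' -> FOSCMS g z0 (jacv g z0 (a *: u, v'))) ->
  nonposv (g z0) -> MFCQ g z0.
Proof.
move=> lin fos gz l lJ l0 lg.
have jacE a v' : dotv l (jacv g z0 (a *: u, v')) = a * dotv l (u *m jacx g z0).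
  rewrite /jacv dotvDr -(mulmx_tr_dotv (jacy g z0)) lJ dotv0l addr0.
  by rewrite /= -scalemxAl dotvZr.
have l_active i : g z0 0 i != 0 -> l 0 i = 0.
  move=> gi; have sum0 : \sum_j - (l 0 j * g z0 0 j) = 0.
    by rewrite sumrN -/(dotv l (g z0)) lg oppr0.
  have := psumr_eq0P _ sum0 => /(_ _ i isT)/wrap[j _|/eqP].
    by rewrite -mulrN mulr_ge0// oppr_ge0.
  by rewrite oppr_eq0 mulf_eq0 (negPf gi) orbF => /eqP.
have le_lin a : a * dotv l (u *m jacx g z0) <= 0.
  have [v' v'P] := lin a; rewrite -(jacE a v'); apply: sumr_le0 => i _.
  have [gi|/l_active->] := eqVneq (g z0 0 i) 0; last by rewrite mul0r.
  by rewrite mulr_ge0_le0// v'P.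
have lu0 : dotv l (u *m jacx g z0) = 0.
  by have := le_lin 1; have := le_lin (-1); lra.
have [v' v'P] := lin 1.
apply: (fos 1 v') => //; last by rewrite jacE lu0 mulr0.
by apply/eqP => -[/eqP]; rewrite oner_eq0.
Qed.

(** Gordan's alternative, from Farkas' lemma applied to the forms
    [(y, tau) |-> grady g_i y + tau]: if these could not be nonpositive with
    [tau > 0], then [tau] would be a nonnegative combination of them, and its
    coefficients would violate MFCQ. *)
Lemma MFCQ_inward : differentiable g z0 -> MFCQ g z0 ->
  exists y : 'rV[R]_m, forall i, g z0 0 i = 0 ->
    dotv (grady (fun z => g z 0 i) z0) y < 0.
Proof.
move=> dg mfcq; apply: contrapT => noy.
pose act i : R := (g z0 0 i == 0)%:R.
pose A i : 'rV[R]_(m + 1) :=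
  act i *: row_mx (grady (fun z => g z 0 i) z0) (1%:M : 'M[R]_1).
have dot1 (x : 'M[R]_1) : dotv (1%:M : 'M[R]_1) x = x 0 0.
  by rewrite /dotv big_ord1 mxE eqxx mul1r.
have [x xA|mu mu0] := @farkas R (m + 1) _ A (row_mx 0 (1%:M : 'M[R]_1)).
  rewrite leNgt; apply/negP => x0; apply: noy; exists (lsubmx x) => i gi.
  rewrite -(hsubmxK x) dotv_row_mx dotv0l add0r dot1 in x0.
  have := xA i; rewrite -(hsubmxK x) /A /act gi eqxx scale1r dotv_row_mx dot1.
  by rewrite !row_mxKl; lra.
move=> E; pose l : 'rV[R]_p := \row_i (mu i * act i).
have AE : \sum_i mu i *: A i =
    row_mx (l *m (jacy g z0)^T) (\sum_i l 0 i *: (1%:M : 'M[R]_1)).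
  rewrite mulmx_jacy// -[LHS]hsubmxK !linear_sum/=; congr row_mx.
    by apply: eq_bigr => i _; rewrite scalerA linearZ/= row_mxKl !mxE.
  by apply: eq_bigr => i _; rewrite scalerA linearZ/= row_mxKr !mxE.
rewrite AE in E; have [E1 E2] := eq_row_mx E.
have l0 : l = 0.
  apply: mfcq => //.
    by move=> i; rewrite mxE mulr_ge0// ler0n.
  apply: big1 => i _; rewrite mxE /act; case: eqP => [->|_].
    by rewrite mulr0.
  by rewrite mulr0 mul0r.
have := congr1 (fun M : 'M[R]_1 => M 0 0) E2.
rewrite l0 big1 => [|i _]; last by rewrite mxE scale0r.
by rewrite !mxE eqxx => /eqP; rewrite oner_eq0.
Qed.

End ConstraintQualification.

(** * Multipliers *)

Section Stationarity.
Context {R : realType} {n m p q : nat}.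
Variables (F f : prodRV R n m -> R).
Variables (g : prodRV R n m -> 'rV[R]_p) (G : prodRV R n m -> 'rV[R]_q).
Variables (z0 d : prodRV R n m) (rho : R).
Hypothesis dg : differentiable g z0.
Hypothesis dG : differentiable G z0.
Hypothesis rho0 : 0 < rho.

Hypothesis first_order : forall (e : prodRV R n m) (xi : 'rV[R]_m),
  (forall i, g z0 0 i = 0 -> gradv (fun z => g z 0 i) z0 (- e.1, xi) <= 0) ->
  (forall i, g z0 0 i = 0 -> gradv (fun z => g z 0 i) z0 d = 0 ->
     gradv (fun z => g z 0 i) z0 e <= 0) ->
  (forall i, G z0 0 i = 0 -> gradv (fun z => G z 0 i) z0 d = 0 ->
     gradv (fun z => G z 0 i) z0 e <= 0) ->
  0 <= gradv F z0 e + rho * dotv (grady f z0) (e.2 + xi).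

(** Farkas' lemma in the variables [(e.1, e.2, xi)]. The coefficient of [xi]
    says that the multipliers of the first family, divided by [rho], belong to
    [multipliers f g z0]; inserting this in the coefficient of [e.2] replaces
    [rho *: grady f z0] by the term with [lambdabar]. *)
Lemma multipliers_of_first_order :
  exists (lambda_g : 'rV[R]_p) (lambda_G : 'rV[R]_q) (lambdabar : 'rV[R]_p),
    multipliers f g z0 lambdabar /\
    (gradx F z0 + (lambda_g - rho *: lambdabar) *m (jacx g z0)^T
       + lambda_G *m (jacx G z0)^T = 0 /\
     grady F z0 + (lambda_g - rho *: lambdabar) *m (jacy g z0)^T
       + lambda_G *m (jacy G z0)^T = 0) /\
    [/\ nonnegv lambda_g, dotv lambda_g (g z0) = 0 &
        dotv lambda_g (jacv g z0 d) = 0] /\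
    [/\ nonnegv lambda_G, dotv lambda_G (G z0) = 0 &
        dotv lambda_G (jacv G z0 d) = 0].
Proof.
(* Indicators switch off the inactive constraints, so that the three
   families can be indexed by all of 'I_p, 'I_p and 'I_q. *)
pose act1 i : R := (g z0 0 i == 0)%:R.
pose act2 i : R := ((g z0 0 i == 0) && (jacv g z0 d 0 i == 0))%:R.
pose act3 i : R := ((G z0 0 i == 0) && (jacv G z0 d 0 i == 0))%:R.
pose gx i := gradx (fun z => g z 0 i) z0.
pose gy i := grady (fun z => g z 0 i) z0.
pose Gx i := gradx (fun z => G z 0 i) z0.
pose Gy i := grady (fun z => G z 0 i) z0.
pose A (j : 'I_p + 'I_p + 'I_q) : 'rV[R]_(n + m + m) :=
  match j with
  | inl (inl i) => act1 i *: row_mx (row_mx (- gx i) 0) (gy i)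
  | inl (inr i) => act2 i *: row_mx (row_mx (gx i) (gy i)) 0
  | inr i => act3 i *: row_mx (row_mx (Gx i) (Gy i)) 0
  end.
pose c : 'rV[R]_(n + m + m) :=
  - row_mx (row_mx (gradx F z0) (grady F z0 + rho *: grady f z0))
           (rho *: grady f z0).
have [x xA|mu mu0 E] := @farkas R (n + m + m) _ A c.
  rewrite -(hsubmxK x) -(hsubmxK (lsubmx x)) /c dotvNl !dotv_row_mx oppr_le0.
  have xE : x = row_mx (row_mx (lsubmx (lsubmx x)) (rsubmx (lsubmx x))) (rsubmx x).
    by rewrite !hsubmxK.
  move: (lsubmx (lsubmx x)) (rsubmx (lsubmx x)) (rsubmx x) xE => x1 x2 x3 xE.
  have -> : dotv (gradx F z0) x1 + dotv (grady F z0 + rho *: grady f z0) x2 +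
      dotv (rho *: grady f z0) x3 =
      gradv F z0 (x1, x2) + rho * dotv (grady f z0) (x2 + x3).
    rewrite /gradv/=; move: (gradx F z0) (grady F z0) (grady f z0) => a b b'.
    by rewrite dotvDl !dotvZl dotvDr; ring.
  have := first_order (e := (x1, x2)) (xi := x3).
  move=> /(_ _ _ _)/wrap[i gi|i gi gdi|i Gi Gdi|//].
  - have := xA (inl (inl i)).
    rewrite /A /act1 gi eqxx scale1r xE !dotv_row_mx dotv0l addr0 dotvNl.
    by rewrite /gradv/= dotvNr.
  - have := xA (inl (inr i)); rewrite gradv_coord// in gdi.
    by rewrite /A /act2 gi gdi eqxx scale1r xE !dotv_row_mx dotv0l addr0.
  - have := xA (inr i); rewrite gradv_coord// in Gdi.
    by rewrite /A /act3 Gi Gdi eqxx scale1r xE !dotv_row_mx dotv0l addr0.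
pose l1 : 'rV[R]_p := \row_i (mu (inl (inl i)) * act1 i).
pose l2 : 'rV[R]_p := \row_i (mu (inl (inr i)) * act2 i).
pose l3 : 'rV[R]_q := \row_i (mu (inr i) * act3 i).
have {E}E : c = row_mx (row_mx
    ((l2 - l1) *m (jacx g z0)^T + l3 *m (jacx G z0)^T)
    (l2 *m (jacy g z0)^T + l3 *m (jacy G z0)^T)) (l1 *m (jacy g z0)^T).
  rewrite E !big_sumType mulmxBl.
  rewrite (mulmx_jacx l1 dg) (mulmx_jacx l2 dg) (mulmx_jacx l3 dG).
  rewrite (mulmx_jacy l1 dg) (mulmx_jacy l2 dg) (mulmx_jacy l3 dG).
  have S1 : \sum_i mu (inl (inl i)) *: A (inl (inl i)) = row_mx (row_mx
      (- (\sum_i l1 0 i *: gx i)) 0) (\sum_i l1 0 i *: gy i).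
    rewrite -[LHS]hsubmxK -[lsubmx _]hsubmxK !linear_sum/=; congr row_mx.
      congr row_mx.
        apply: eq_bigr => i _.
        by rewrite scalerA !linearZ/= !row_mxKl !mxE scalerN.
      by apply: big1 => i _; rewrite scalerA !linearZ/= row_mxKl row_mxKr scaler0.
    by apply: eq_bigr => i _; rewrite scalerA linearZ/= row_mxKr !mxE.
  have S2 : \sum_i mu (inl (inr i)) *: A (inl (inr i)) = row_mx (row_mx
      (\sum_i l2 0 i *: gx i) (\sum_i l2 0 i *: gy i)) 0.
    rewrite -[LHS]hsubmxK -[lsubmx _]hsubmxK !linear_sum/=; congr row_mx.
      congr row_mx; apply: eq_bigr => i _.
        by rewrite scalerA !linearZ/= !row_mxKl !mxE.
      by rewrite scalerA !linearZ/= row_mxKl row_mxKr !mxE.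
    by apply: big1 => i _; rewrite scalerA linearZ/= row_mxKr scaler0.
  have S3 : \sum_i mu (inr i) *: A (inr i) = row_mx (row_mx
      (\sum_i l3 0 i *: Gx i) (\sum_i l3 0 i *: Gy i)) 0.
    rewrite -[LHS]hsubmxK -[lsubmx _]hsubmxK !linear_sum/=; congr row_mx.
      congr row_mx; apply: eq_bigr => i _.
        by rewrite scalerA !linearZ/= !row_mxKl !mxE.
      by rewrite scalerA !linearZ/= row_mxKl row_mxKr !mxE.
    by apply: big1 => i _; rewrite scalerA linearZ/= row_mxKr scaler0.
  rewrite S1 S2 S3 /= !add_row_mx !addr0 add0r.
  by congr (row_mx (row_mx (_ + _) _) _); rewrite addrC.
move: E; rewrite /c !opp_row_mx => /eq_row_mx[/eq_row_mx[Ex Ey] Exi].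
have rho_neq0 : rho != 0 by rewrite gt_eqF.
exists l2, l3, (rho^-1 *: l1).
have comp k (mu' : 'I_k -> R) (P : pred 'I_k) (b : 'rV[R]_k) :
    (forall i, P i -> b 0 i = 0) ->
    dotv (\row_i (mu' i * (P i)%:R)) b = 0.
  move=> Pb; apply: big1 => i _; rewrite mxE.
  by case: (boolP (P i)) => [/Pb->|_]; rewrite mulr0 ?mul0r.
split; [split|split; [split|split; split]].
- move=> i; rewrite !mxE; apply: mulr_ge0; first by rewrite invr_ge0 ltW.
  by rewrite mulr_ge0// ler0n.
- by rewrite -scalemxAl -Exi scalerN scalerA mulVf// scale1r subrr.
- by rewrite dotvZr dotvC comp ?mulr0// => i /eqP.
- by rewrite scalerA divff// scale1r -addrA -Ex subrr.
- rewrite scalerA divff// scale1r mulmxBl -Exi opprK.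
  by rewrite [l2 *m _ + _]addrC [grady F z0 + _]addrA -[LHS]addrA -Ey subrr.
- by move=> i; rewrite mxE mulr_ge0// ler0n.
- by apply: comp => i /andP[/eqP].
- by apply: comp => i /andP[_ /eqP].
- by move=> i; rewrite mxE mulr_ge0// ler0n.
- by apply: comp => i /andP[/eqP].
- by apply: comp => i /andP[_ /eqP].
Qed.

End Stationarity.

Theorem theorem5p4 (R : realType) (n m p q : nat)
  (F f : 'rV[R]_n * 'rV[R]_m -> R)
  (G : 'rV[R]_n * 'rV[R]_m -> 'rV[R]_q)
  (g : 'rV[R]_n * 'rV[R]_m -> 'rV[R]_p)
  (rho_f gamma : R)
  (zbar : 'rV[R]_n * 'rV[R]_m) (u : 'rV[R]_n) (v : 'rV[R]_m)
  (F_C1 : C1_scalar F) (f_C1 : C1_scalar f)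
  (G_C1 : C1_vector G) (g_C1 : C1_vector g)
  (f_wconvex : forall x, weakly_convex rho_f (fun y => f (x, y)))
  (g_qconvex : forall x i, quasi_convex (fun y => g (x, y) 0 i))
  (gamma_gt0 : 0 < gamma)
  (gamma_lt : 0 < rho_f -> gamma < 1 / (2 * rho_f))
  (zbar_min : VP_local_minimizer F f g G gamma zbar)
  (uv_crit : critical_cone F f g G gamma zbar (u, v))
  (CQ : MFCQ g zbar \/
        [/\ u *m jacx g zbar != 0,
            forall a : R, linearized_dirs g zbar (a *: u) !=set0,
            MSCQ g zbar &
            forall (a : R) (v' : 'rV[R]_m), (a, v') != 0 ->
              linearized_dirs g zbar (a *: u) v' ->
              FOSCMS g zbar (jacv g zbar (a *: u, v'))])
  (calm : partially_calm F f g G gamma zbar (u, v)) :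
  exists (alpha : R) (lambda_g : 'rV[R]_p) (lambda_G : 'rV[R]_q)
         (lambdabar : 'rV[R]_p),
    multipliers f g zbar lambdabar /\
    [/\ gradx F zbar + (lambda_g - alpha *: lambdabar) *m (jacx g zbar)^T
          + lambda_G *m (jacx G zbar)^T = 0,
        grady F zbar + (lambda_g - alpha *: lambdabar) *m (jacy g zbar)^T
          + lambda_G *m (jacy G zbar)^T = 0 &
        0 <= alpha] /\
    [/\ nonnegv lambda_g, dotv lambda_g (g zbar) = 0 &
        dotv lambda_g (jacv g zbar (u, v)) = 0] /\
    [/\ nonnegv lambda_G, dotv lambda_G (G zbar) = 0 &
        dotv lambda_G (jacv G zbar (u, v)) = 0].
Proof.
have [[fz_le gz Gz] _] := zbar_min.
have gz' : lower_feasible g zbar.1 zbar.2.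
  exact: lower_feasible_self.
have env_le := moreau_env_le f gamma gz'; rewrite prox_obj_self in env_le.
have env_eq : moreau_env f g gamma zbar = (f zbar)%:E.
  case: (moreau_env f g gamma zbar) fz_le env_le => [r||]//=.
  by rewrite -EFinB !lee_fin => r1 r2; congr (_%:E); lra.
have mfcq : MFCQ g zbar by case: CQ => // -[_ lin _ fos]; exact: FOSCMS_MFCQ lin fos gz.
have [y gy] := MFCQ_inward (g_C1.1 zbar) mfcq.
have f_cont : continuous f by move=> z; exact: differentiable_continuous (f_C1.1 z).
have g_cont i : continuous (fun z => g z 0 i).
  by move=> z; exact: differentiable_continuous ((C1_coord i g_C1).1 z).
have env_ge : ((f zbar)%:E <= moreau_env f g gamma zbar)%E by rewrite env_eq.
have stable (e : R) (e0 : 0 < e) := prox_stable f_wconvex g_qconvex gamma_gt0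
  gamma_lt f_cont g_cont env_ge gz' e0.
have [eps0 [delta [rho [eps00 delta0 rho0 calmP]]]] := calm.
have first_order e xi :
    (forall i, g zbar 0 i = 0 ->
       gradv (fun z => g z 0 i) zbar (- e.1, xi) <= 0) ->
    (forall i, g zbar 0 i = 0 -> gradv (fun z => g z 0 i) zbar (u, v) = 0 ->
       gradv (fun z => g z 0 i) zbar e <= 0) ->
    (forall i, G zbar 0 i = 0 -> gradv (fun z => G z 0 i) zbar (u, v) = 0 ->
       gradv (fun z => G z 0 i) zbar e <= 0) ->
    0 <= gradv F zbar e + rho * dotv (grady f zbar) (e.2 + xi).
  move=> xi_in ge Ge.
  (* Adding [tau *: y] to [e.2] and [xi] makes the conditions on [g] strict; the
     conditions on [G] are spoilt by at most [tau * C]. *)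
  pose C := 1 + \sum_i `|dotv (grady (fun z => G z 0 i) zbar) y|.
  have C0 : 0 < C by rewrite ltr_pwDl// sumr_ge0.
  pose K := dotv (grady F zbar) y + rho * (2 * dotv (grady f zbar) y + q%:R * C).
  apply: (@ge0_of_perturbation R _ K) => tau tau0.
  pose e' : 'rV[R]_n * 'rV[R]_m := (e.1, e.2 + tau *: y).
  have pertE h : gradv h zbar e' = gradv h zbar e + tau * dotv (grady h zbar) y.
    by rewrite /gradv/= dotvDr dotvZr addrA.
  have pert_xiE h : gradv h zbar (- e'.1, xi + tau *: y) =
      gradv h zbar (- e.1, xi) + tau * dotv (grady h zbar) y.
    by rewrite /gradv/= dotvDr dotvZr addrA.
  have := calm_first_order F_C1 f_C1 g_C1 G_C1 gamma_gt0 gz Gz env_eq stable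
    uv_crit (e := e') (xi := xi + tau *: y) (c := tau * C)
    eps00 delta0 rho0 calmP (mulr_gt0 tau0 C0).
  move=> /(_ _ _ _)/wrap[i gi|i gi gdi|i Gi Gdi|].
  - have := gy i gi; rewrite pert_xiE -(pmulr_rlt0 _ tau0).
    by have := xi_in i gi; lra.
  - have := gy i gi; rewrite pertE -(pmulr_rlt0 _ tau0).
    by have := ge i gi gdi; lra.
  - have : tau * dotv (grady (fun z => G z 0 i) zbar) y <= tau * C.
      rewrite ler_pM2l// (le_trans (ler_norm _))// /C (bigD1 i)//= addrCA lerDl.
      by rewrite addr_ge0// sumr_ge0.
    by rewrite pertE; have := Ge i Gi Gdi; lra.
  have <- : gradv f zbar e + gradv f zbar (- e.1, xi) =
      dotv (grady f zbar) (e.2 + xi).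
    by rewrite /gradv (dotvNr (gradx f zbar)) (dotvDr (grady f zbar)) addrACA subrr add0r.
  have collect (a b b' x z k : R) :
      a + tau * x + rho * (b + tau * z + (b' + tau * z) + k * (tau * C)) =
      a + rho * (b + b') + tau * (x + rho * (2 * z + k * C)) by ring.
  by rewrite (pertE F) (pertE f) (pert_xiE f) /K collect.
have [lambda_g [lambda_G [lambdabar [Lb [[Ex Ey] [cg cG]]]]]] :=
  multipliers_of_first_order (g_C1.1 zbar) (G_C1.1 zbar) rho0 first_order.
by exists rho, lambda_g, lambda_G, lambdabar; do 3![split=> //]; exact: ltW.
Qed.
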